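(* Let $E$ and $F$ be real Banach lattices such that $E^*$ and $F^*$ are lattice isomorphic and at least one of $E^*$, $F^*$ has order continuous norm. Then for every $n\in\mathbb{N}$ and every Banach lattice $G$, the Banach lattices $\mathcal{P}^r(^nE;G^* )$ and $\mathcal{P}^r(^nF;G^* )$ are lattice isomorphic.
   Context: An $n$-homogeneous polynomial $P\colon E\to H$ between Banach lattices is positive if its associated symmetric $n$-linear map is positive (nonnegative on tuples of nonnegative vectors). $\mathcal{P}^r(^nE;H)$ denotes the space of regular $n$-homogeneous polynomials (differences of positive ones); when $H$ is Dedekind complete (e.g. $H=G^*$) it is a Banach lattice with the regular norm $\|P\|_r=\||P|\|$. A lattice isomorphism is a linear bijection that preserves lattice operations (equivalently, it and its inverse are positive). *)

(* Defs.v *)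
From HB Require Import structures.
From mathcomp Require Import all_boot all_order all_algebra fingroup perm.
From mathcomp Require Import all_classical all_reals all_analysis.
Set Implicit Arguments. Unset Strict Implicit. Unset Printing Implicit Defensive.
Import Order.TTheory GRing.Theory Num.Theory.
Import numFieldNormedType.Exports.
Local Open Scope classical_set_scope.
Local Open Scope ring_scope.

Section BL.
Variable R : realType.

Definition is_sup2 (E : Type) (le : E -> E -> Prop) (x y s : E) : Prop :=
  le x s /\ le y s /\ forall u, le x u -> le y u -> le s u.

Definition is_banach_lattice (E : normedModType R) (le : E -> E -> Prop) : Prop :=
  ((forall x, le x x) /\
      (forall x y, le x y -> le y x -> x = y) /\
      (forall x y z, le x y -> le y z -> le x z) /\
      (forall x y z, le x y -> le (x + z) (y + z)) /\
      (forall (a : R) x y, 0 <= a -> le x y -> le (a *: x) (a *: y)) /\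
      (forall x y, exists s, is_sup2 le x y s) /\
      (forall x y ax ay, is_sup2 le x (- x) ax -> is_sup2 le y (- y) ay ->
          le ax ay -> `|x| <= `|y|)).

Definition is_dual_elem (E : normedModType R) (f : E -> R) : Prop :=
  ((forall x y, f (x + y) = f x + f y) /\
      (forall (a : R) x, f (a *: x) = a * f x) /\
      exists C : R, forall x, `|f x| <= C * `|x|).

Definition dual_le (E : normedModType R) (le : E -> E -> Prop) (f g : E -> R) :=
  forall x, le 0 x -> f x <= g x.

Definition dual_norm (E : normedModType R) (f : E -> R) : R :=
  sup [set `|f x| | x in [set x : E | `|x| <= 1]].

Definition dual_order_continuous (E : normedModType R) (le : E -> E -> Prop) :=
  forall (I : Type) (r : I -> I -> Prop) (f : I -> E -> R),
    (exists i : I, True) ->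
    (forall i, r i i) -> (forall i j k, r i j -> r j k -> r i k) ->
    (forall i j, exists k, r i k /\ r j k) ->
    (forall i, is_dual_elem (f i)) ->
    (forall i j, r i j -> dual_le le (f j) (f i)) ->
    (forall i, dual_le le (fun _ => 0) (f i)) ->
    (forall h, is_dual_elem h -> (forall i, dual_le le h (f i)) ->
        dual_le le h (fun _ => 0)) ->
    forall eps : R, 0 < eps -> exists i, forall j, r i j -> dual_norm (f j) < eps.

Definition dual_lattice_iso (E F : normedModType R)
    (leE : E -> E -> Prop) (leF : F -> F -> Prop)
    (T : (E -> R) -> (F -> R)) : Prop :=
  ((forall f, is_dual_elem f -> is_dual_elem (T f)) /\
      (forall f g, is_dual_elem f -> is_dual_elem g ->
          T (fun x => f x + g x) = (fun y => T f y + T g y)) /\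
      (forall (a : R) f, is_dual_elem f -> T (fun x => a * f x) = (fun y => a * T f y)) /\
      (forall f g, is_dual_elem f -> is_dual_elem g -> T f = T g -> f = g) /\
      (forall g, is_dual_elem g -> exists2 f, is_dual_elem f & T f = g) /\
      (forall f, is_dual_elem f -> dual_le leE (fun _ => 0) f ->
          dual_le leF (fun _ => 0) (T f)) /\
      (forall f, is_dual_elem f -> dual_le leF (fun _ => 0) (T f) ->
          dual_le leE (fun _ => 0) f)).

Definition duals_lattice_isomorphic (E F : normedModType R)
    (leE : E -> E -> Prop) (leF : F -> F -> Prop) : Prop :=
  exists T, dual_lattice_iso leE leF T.

Definition upd (E : Type) (n : nat) (xs : 'I_n -> E) (i : 'I_n) (x : E) : 'I_n -> E :=
  fun j => if j == i then x else xs j.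

Definition sym_multilinear (E G : normedModType R) (n : nat)
    (A : ('I_n -> E) -> G -> R) : Prop :=
  ((forall xs, is_dual_elem (A xs)) /\
      (forall xs i x y, A (upd xs i (x + y)) =
          (fun g => A (upd xs i x) g + A (upd xs i y) g)) /\
      (forall xs i (a : R) x, A (upd xs i (a *: x)) = (fun g => a * A (upd xs i x) g)) /\
      (forall xs (s : 'S_n), A (fun j => xs (s j)) = A xs) /\
      exists C : R, forall xs g, `|A xs g| <= C * (\prod_(i < n) `|xs i|) * `|g|).

Definition assoc_sym (E G : normedModType R) (n : nat)
    (P : E -> G -> R) (A : ('I_n -> E) -> G -> R) : Prop :=
  sym_multilinear A /\ forall x, P x = A (fun _ => x).

Definition pos_poly (E G : normedModType R) (leE : E -> E -> Prop)
    (leG : G -> G -> Prop) (n : nat) (P : E -> G -> R) : Prop :=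
  exists A : ('I_n -> E) -> G -> R, assoc_sym P A /\
    forall xs, (forall i, leE 0 (xs i)) -> dual_le leG (fun _ => 0) (A xs).

Definition reg_poly (E G : normedModType R) (leE : E -> E -> Prop)
    (leG : G -> G -> Prop) (n : nat) (P : E -> G -> R) : Prop :=
  exists P1 P2, pos_poly leE leG n P1 /\ pos_poly leE leG n P2 /\
    P = (fun x g => P1 x g - P2 x g).

Definition poly_lattice_iso (E F G : normedModType R)
    (leE : E -> E -> Prop) (leF : F -> F -> Prop) (leG : G -> G -> Prop) (n : nat)
    (T : (E -> G -> R) -> (F -> G -> R)) : Prop :=
  ((forall P, reg_poly leE leG n P -> reg_poly leF leG n (T P)) /\
      (forall P Q, reg_poly leE leG n P -> reg_poly leE leG n Q ->
          T (fun x g => P x g + Q x g) = (fun y g => T P y g + T Q y g)) /\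
      (forall (a : R) P, reg_poly leE leG n P ->
          T (fun x g => a * P x g) = (fun y g => a * T P y g)) /\
      (forall P Q, reg_poly leE leG n P -> reg_poly leE leG n Q -> T P = T Q -> P = Q) /\
      (forall Q, reg_poly leF leG n Q -> exists2 P, reg_poly leE leG n P & T P = Q) /\
      (forall P, reg_poly leE leG n P -> pos_poly leE leG n P -> pos_poly leF leG n (T P)) /\
      (forall P, reg_poly leE leG n P -> pos_poly leF leG n (T P) -> pos_poly leE leG n P)).

Definition polys_lattice_isomorphic (E F G : normedModType R)
    (leE : E -> E -> Prop) (leF : F -> F -> Prop) (leG : G -> G -> Prop) (n : nat) :=
  exists T, poly_lattice_iso leE leF leG n T.

End BL.

(* Main.v *)
(* Write J y for the functional f |-> (T f)(y) on the positive cone of the dual of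
   E, where y is in F. Since T is an order isomorphism and infima of downward
   directed families in a dual are computed pointwise, J y is order continuous for
   y >= 0. Applying J to the variables of a positive symmetric n-linear map one
   after the other (an Arens extension restricted to F) turns maps on E into maps
   on F.

   The heart of the matter is that the order in which the variables are treated is
   irrelevant, that is, phi (x |-> psi (B x .)) = psi (y |-> phi (B . y)) for
   positive bilinear B and order continuous phi, psi >= 0. For a given functional
   f >= 0, such a phi is approximated uniformly on the order interval [0, f] by
   evaluation at a point of E: first phi is dominated on [0, f] by evaluation at
   some u >= 0 up to a small error, then the distance to E is halved repeatedly by
   means of approximate Hahn decompositions of phi minus a point. Since evaluations
   commute with psi, so does phi.

   Interchangeability makes the extension symmetric, and extending back by the
   inverse of T cancels the extension variable by variable. Polarization passes
   from symmetric maps to polynomials. *)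

Require Import Defs.
From HB Require Import structures.
From mathcomp Require Import all_boot all_order all_algebra fingroup perm.
From mathcomp Require Import all_classical all_reals all_analysis.
From mathcomp Require Import ring lra.
Import Order.TTheory GRing.Theory Num.Theory.
Import numFieldNormedType.Exports.

Set Implicit Arguments.
Unset Strict Implicit.
Unset Printing Implicit Defensive.

Local Open Scope classical_set_scope.
Local Open Scope ring_scope.

(** * Cones with the refinement property *)

Section Cones.
Variable R : realType.

Definition additive_on (V : zmodType) (C : V -> Prop) (q : V -> R) :=
  forall x y, C x -> C y -> q (x + y) = q x + q y.

Definition nonneg_on (V : Type) (C : V -> Prop) (q : V -> R) :=
  forall x, C x -> 0 <= q x.

(** The Riesz refinement property, stated without lattice operations so that it covers the cone of a
    Banach lattice, the positive functionals on it and product cones alike. *)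
Definition refinable (V : zmodType) (C : V -> Prop) :=
  [/\ C 0, forall x y, C x -> C y -> C (x + y) &
    forall x y z w, C x -> C y -> C z -> C w -> x + y = z + w ->
    exists a b c d, [/\ C a, C b, C c & C d] /\
      [/\ x = a + b, y = c + d, z = a + c & w = b + d]].

Definition riesz_cone (V : lmodType R) (C : V -> Prop) :=
  [/\ refinable C, forall (a : R) x, 0 <= a -> C x -> C (a *: x) &
    forall x, exists p n, [/\ C p, C n & x = p - n]].

Section InfConvolution.
Variables (V : zmodType) (C : V -> Prop) (p q : V -> R).
Hypotheses (hC : refinable C).
Hypotheses (pD : additive_on C p) (p_ge0 : nonneg_on C p).
Hypotheses (qD : additive_on C q) (q_ge0 : nonneg_on C q).

Definition splitting_values (z : V) : set R :=
  [set r | exists x y, [/\ C x, C y, x + y = z & r = p x + q y]].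

(** The Riesz-Kantorovich formula for a meet. It serves at two levels: for functionals on E, and for
    functionals on the cone of positive functionals. *)
Definition inf_convolution (z : V) : R := inf (splitting_values z).

Lemma splitting_values_has_inf z : C z -> has_inf (splitting_values z).
Proof.
move=> Cz; have [C0 _ _] := hC; split.
  by exists (p z + q 0), z, 0; split => //; rewrite addr0.
by exists 0 => _ [x [y [Cx Cy _ ->]]]; rewrite addr_ge0 ?p_ge0 ?q_ge0.
Qed.

Lemma inf_convolution_le x y : C x -> C y ->
  inf_convolution (x + y) <= p x + q y.
Proof.
move=> Cx Cy; have [_ CD _] := hC.
apply: ge_inf; last by exists x, y.
by have [] := splitting_values_has_inf (CD _ _ Cx Cy).
Qed.

Lemma le_inf_convolution z r : C z ->
  (forall x y, C x -> C y -> x + y = z -> r <= p x + q y) ->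
  r <= inf_convolution z.
Proof.
move=> Cz h; apply: lb_le_inf; first by have [] := splitting_values_has_inf Cz.
by move=> _ [x [y [Cx Cy xy ->]]]; apply: h.
Qed.

Lemma inf_convolution_adherent z e : C z -> 0 < e ->
  exists x y, [/\ C x, C y, x + y = z & p x + q y <= inf_convolution z + e].
Proof.
move=> Cz e0; have [_ [x [y [Cx Cy xy ->]]] he] :=
  inf_adherent e0 (splitting_values_has_inf Cz).
by exists x, y; split=> //; apply: ltW.
Qed.

Lemma inf_convolution_ge0 : nonneg_on C inf_convolution.
Proof.
move=> z Cz; apply: le_inf_convolution => // x y Cx Cy _.
by rewrite addr_ge0 ?p_ge0 ?q_ge0.
Qed.

Lemma inf_convolution_lel z : C z -> inf_convolution z <= p z.
Proof.
move=> Cz; have [C0 _ _] := hC.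
have := inf_convolution_le Cz C0; rewrite addr0.
by have := qD C0 C0; rewrite addr0; lra.
Qed.

Lemma inf_convolution_ler z : C z -> inf_convolution z <= q z.
Proof.
move=> Cz; have [C0 _ _] := hC.
have := inf_convolution_le C0 Cz; rewrite add0r.
by have := pD C0 C0; rewrite addr0; lra.
Qed.

(** Near-optimal splittings of z and w add up to a splitting of z + w, which gives one inequality.
    For the other, refinement cuts any splitting of z + w into splittings of z and of w. *)
Lemma inf_convolutionD : additive_on C inf_convolution.
Proof.
move=> z w Cz Cw; have [C0 CD Cref] := hC; apply/eqP; rewrite eq_le.
apply/andP; split.
  apply/ler_addgt0Pr => e e0; have e2 : 0 < e / 2 by lra.
  have [x [y [Cx Cy <-]]] := inf_convolution_adherent Cz e2.
  have [x' [y' [Cx' Cy' <-]]] := inf_convolution_adherent Cw e2.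
  have := inf_convolution_le (CD _ _ Cx Cx') (CD _ _ Cy Cy').
  rewrite pD // qD // addrACA.
  lra.
apply: le_inf_convolution; first exact: CD.
move=> x y Cx Cy xy.
have [a [b [c [d [[Ca Cb Cc Cd] [-> -> -> ->]]]]]] := Cref _ _ _ _ Cx Cy Cz Cw xy.
have := inf_convolution_le Ca Cc; have := inf_convolution_le Cb Cd.
rewrite pD // qD //; lra.
Qed.

End InfConvolution.

(** Additivity settles natural multiples. With m the integer part of n a, monotonicity places both
    q(n a x) and n a q(x) between m q(x) and (m + 1) q(x), so n times the defect is at most q(x) for
    every n. *)
Lemma nonneg_additive_homogeneous (V : lmodType R) (C : V -> Prop) (q : V -> R) :
  C 0 -> (forall x y, C x -> C y -> C (x + y)) ->
  (forall (a : R) x, 0 <= a -> C x -> C (a *: x)) ->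
  additive_on C q -> nonneg_on C q ->
  forall (a : R) x, 0 <= a -> C x -> q (a *: x) = a * q x.
Proof.
move=> C0 CD CZ qD q0 a x a0 Cx.
have qn n y : C y -> q (n%:R *: y) = n%:R * q y.
  move=> Cy; elim: n => [|n ih].
    by rewrite scale0r mul0r; have := qD 0 0 C0 C0; rewrite addr0; lra.
  by rewrite -natr1 scalerDl scale1r qD ?ih ?mulrDl ?mul1r //; apply: CZ.
have qmon s t : 0 <= s -> s <= t -> q (s *: x) <= q (t *: x).
  move=> s0 st; have -> : t = s + (t - s) by lra.
  have ts : 0 <= t - s by lra.
  by rewrite scalerDl qD ?lerDl ?q0 //; apply: CZ.
have key (n : nat) : n%:R * `|q (a *: x) - a * q x| <= q x.
  have na0 : 0 <= n%:R * a :> R by rewrite mulr_ge0.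
  have /andP[h1 h2] := truncn_itv na0.
  have := qmon _ _ (ler0n _ _) h1; have := qmon _ _ na0 (ltW h2).
  rewrite !qn // -scalerA qn; last exact: CZ.
  have := q0 _ Cx.
  set m := Num.truncn _ in h1 h2 *; rewrite -natr1 in h2 *.
  set u := q (a *: x) => qx0 k1 k2.
  have l1 : m%:R * q x <= n%:R * a * q x by rewrite ler_wpM2r.
  have l2 : n%:R * a * q x <= (m%:R + 1) * q x by rewrite ler_wpM2r // ltW.
  rewrite -[n%:R in X in X <= _]ger0_norm // -normrM ler_norml.
  by apply/andP; split; lra.
apply/eqP; rewrite -subr_eq0 -normr_le0 leNgt; apply/negP => d0.
have := key (Num.bound (q x / `|q (a *: x) - a * q x|)).
apply/negP; rewrite -ltNge -ltr_pdivrMr //.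
by apply: archi_boundP; rewrite divr_ge0 ?q0.
Qed.

End Cones.

(** * Positive functionals *)

Section PositiveFunctionals.
Variables (R : realType) (E : lmodType R) (C : E -> Prop).
Hypothesis hC : riesz_cone C.

(** Continuity is not built in; on a Banach lattice [pos_functional_dual] supplies it. *)
Definition pos_functional (f : E -> R) :=
  [/\ forall x y, f (x + y) = f x + f y,
      forall (a : R) x, f (a *: x) = a * f x & nonneg_on C f].

Definition fle (f g : E -> R) := forall x, C x -> f x <= g x.

Local Notation pf := pos_functional.

Lemma pf_additive_on f : pf f -> additive_on C f.
Proof. by case=> fD _ _ x y _ _; apply: fD. Qed.

Lemma pfB f : pf f -> forall x y, f (x - y) = f x - f y.
Proof. by case=> fD fZ _ x y; rewrite fD -scaleN1r fZ mulN1r. Qed.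

Lemma pf0 : pf 0.
Proof.
by split=> [x y|a x|x _]; rewrite ?fctE ?addr0 ?mulr0.
Qed.

Lemma pf_add f g : pf f -> pf g -> pf (f + g).
Proof.
move=> [fD fZ f0] [gD gZ g0]; split=> [x y|a x|x Cx]; rewrite !fctE.
- by rewrite fD gD addrACA.
- by rewrite fZ gZ mulrDr.
- by rewrite addr_ge0 ?f0 ?g0.
Qed.

Lemma pf_sub f g : pf f -> pf g -> fle g f -> pf (f - g).
Proof.
move=> [fD fZ f0] [gD gZ g0] gf; split=> [x y|a x|x Cx]; rewrite !fctE.
- by rewrite fD gD opprD addrACA.
- by rewrite fZ gZ mulrBr.
- by rewrite subr_ge0 gf.
Qed.

Lemma pf_eq f g : pf f -> pf g -> (forall x, C x -> f x = g x) -> f = g.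
Proof.
move=> hf hg fg; apply/funext => x; have [_ _ /(_ x)[p [n [Cp Cn ->]]]] := hC.
by rewrite !pfB // !fg.
Qed.

(** Kantorovich extension: f(p - n) = q(p) - q(n) does not depend on the decomposition because q is
    additive, and homogeneity comes from [nonneg_additive_homogeneous]. *)
Lemma pf_extension (q : E -> R) : additive_on C q -> nonneg_on C q ->
  exists f, pf f /\ forall x, C x -> f x = q x.
Proof.
move=> qD q0; have [[C0 CD _] CZ Cgen] := hC.
have qZ := nonneg_additive_homogeneous C0 CD CZ qD q0.
have /choice[pn hpn] (x : E) :
    exists pn : E * E, [/\ C pn.1, C pn.2 & x = pn.1 - pn.2].
  by have [p [n [Cp Cn xE]]] := Cgen x; exists (p, n).
pose f x := q (pn x).1 - q (pn x).2.
have fE p n : C p -> C n -> f (p - n) = q p - q n.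
  move=> Cp Cn; have [C1 C2 e] := hpn (p - n); rewrite /f.
  set a := (pn _).1 in C1 e *; set b := (pn _).2 in C2 e *.
  have : q (p + b) = q (a + n).
    by congr q; rewrite -[p](subrK n) e addrAC subrK.
  by rewrite !qD //; lra.
have fq x : C x -> f x = q x.
  move=> Cx; rewrite -[x]subr0 fE // subr0.
  by have := qD _ _ C0 C0; rewrite addr0; lra.
have fD x y : f (x + y) = f x + f y.
  have [p [n [Cp Cn ->]]] := Cgen x; have [p' [n' [Cp' Cn' ->]]] := Cgen y.
  by rewrite addrACA -opprD !fE ?qD //; first [exact: CD | lra].
have fN x : f (- x) = - f x.
  by have [p [n [Cp Cn ->]]] := Cgen x; rewrite opprB !fE // opprB.
have fZ (a : R) x : f (a *: x) = a * f x.
  have [p [n [Cp Cn ->]]] := Cgen x.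
  wlog a0 : a / 0 <= a.
    move=> H; have [|/ltW a0] := lerP 0 a; first exact: H.
    have Na0 : 0 <= - a by lra.
    by have := H _ Na0; rewrite scaleNr fN mulNr => /oppr_inj.
  by rewrite scalerBr !fE ?qZ ?mulrBr //; apply: CZ.
by exists f; split=> //; split=> // x Cx; rewrite fq ?q0.
Qed.

(* The last clause is the Riesz-Kantorovich formula for the meet. *)
Lemma pf_meet f g : pf f -> pf g -> exists m, [/\ pf m, fle m f, fle m g,
  forall r, (forall x y, r (x + y) = r x + r y) -> fle r f -> fle r g -> fle r m &
  forall x e, C x -> 0 < e ->
    exists x1 x2, [/\ C x1, C x2, x1 + x2 = x & f x1 + g x2 <= m x + e]].
Proof.
move=> hf hg; have [hCr _ _] := hC.
have [fA gA] := (pf_additive_on hf, pf_additive_on hg).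
have [[_ _ f0] [_ _ g0]] := (hf, hg).
have [m [hm mE]] := pf_extension (inf_convolutionD hCr fA f0 gA g0)
  (inf_convolution_ge0 hCr f0 g0).
exists m; split=> //.
- by move=> x Cx; rewrite mE //; apply: inf_convolution_lel.
- by move=> x Cx; rewrite mE //; apply: inf_convolution_ler.
- move=> r rD rf rg x Cx; rewrite mE //; apply: le_inf_convolution => // a b Ca Cb <-.
  by rewrite rD lerD ?rf ?rg.
- by move=> x e Cx e0; rewrite mE //; apply: inf_convolution_adherent.
Qed.

(** The join is f + g - m with m the meet; it stays below h because f + g - h lies below both f and
    g. *)
Lemma pf_join f g h : pf f -> pf g -> pf h -> fle f h -> fle g h ->
  exists j, [/\ pf j, fle f j, fle g j, fle j h & fle j (f + g)].
Proof.
move=> hf hg hh fh gh; have [m [hm mf mg mglb _]] := pf_meet hf hg.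
have [[[[fD _ _] [gD _ _]] [hD _ _]] [_ _ m0]] := (hf, hg, hh, hm).
have hfg := pf_add hf hg.
exists (f + g - m); split.
- apply: pf_sub => // x Cx; rewrite fctE.
  by have := mf _ Cx; have [_ _ /(_ _ Cx)] := hg; lra.
- by move=> x Cx; rewrite !fctE; have := mg _ Cx; lra.
- by move=> x Cx; rewrite !fctE; have := mf _ Cx; lra.
- move=> x Cx; rewrite !fctE.
  have : f x + g x - h x <= m x; last by lra.
  apply: (mglb (fun x => f x + g x - h x)) => // [y z|y Cy|y Cy].
  + by rewrite fD gD hD; lra.
  + by have := gh _ Cy; lra.
  + by have := fh _ Cy; lra.
- by move=> x Cx; rewrite !fctE; have := m0 _ Cx; lra.
Qed.

(** The meet m of f and h is the common piece. The remainder h - m lies below g because h - g is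
    below both f and h. *)
Lemma pf_refinable : refinable pf.
Proof.
split; [exact: pf0 | exact: pf_add |].
move=> f g h k hf hg hh hk e.
have [m [hm mf mh mglb _]] := pf_meet hf hh.
have eE x : f x + g x = h x + k x by have := congr1 (@^~ x) e.
have hmg : fle (h - m) g.
  move=> x Cx; rewrite !fctE.
  have : h x - g x <= m x; last by lra.
  have [[hD _ _] [gD _ _]] := (hh, hg).
  apply: (mglb (fun x => h x - g x)) => // [y z|y Cy|y Cy].
  + by rewrite hD gD; lra.
  + by have [_ _ /(_ _ Cy)] := hk; have := eE y; lra.
  + by have [_ _ /(_ _ Cy)] := hg; lra.
have hhm := pf_sub hh hm mh.
exists m, (f - m), (h - m), (g - (h - m)); split; split=> //.
- exact: pf_sub.
- exact: pf_sub.
- by rewrite addrC subrK.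
- by rewrite addrC subrK.
- by rewrite addrC subrK.
- by apply/funext => x; rewrite !fctE; have := eE x; lra.
Qed.

Lemma pf_split h f g : pf h -> pf f -> pf g -> fle h (f + g) ->
  exists h1 h2, [/\ pf h1, pf h2, h = h1 + h2, fle h1 f & fle h2 g].
Proof.
move=> hh hf hg hfg; have [_ _ ref] := pf_refinable.
have hr := pf_sub (pf_add hf hg) hh hfg.
have e : h + (f + g - h) = f + g by rewrite addrC subrK.
have [a [b [c [d [[ha hb hc hd] [-> _ -> ->]]]]]] := ref _ _ _ _ hh hr hf hg e.
exists a, b; split=> // x Cx; rewrite fctE lerDl.
  by have [_ _] := hc; apply.
by have [_ _] := hd; apply.
Qed.

End PositiveFunctionals.

(** * Order continuous functionals on the dual cone *)

Section NormalFunctionals.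
Variables (R : realType) (E : lmodType R) (C : E -> Prop).
Hypothesis hC : riesz_cone C.

Local Notation pf := (pos_functional C).
Local Notation fle := (fle C).

(** That a downward directed set decreases to 0 is expressed pointwise on C, which is how infima of
    such sets of positive functionals are computed. *)
Definition order_continuous (phi : (E -> R) -> R) :=
  forall D : (E -> R) -> Prop,
    (exists h, D h) -> (forall h, D h -> pf h) ->
    (forall h1 h2, D h1 -> D h2 -> exists h3, [/\ D h3, fle h3 h1 & fle h3 h2]) ->
    (forall x e, C x -> 0 < e -> exists h, D h /\ h x <= e) ->
    forall e, 0 < e -> exists h, D h /\ phi h <= e.

Definition normal (phi : (E -> R) -> R) :=
  [/\ additive_on pf phi, nonneg_on pf phi & order_continuous phi].

Lemma additive_on0 (V : zmodType) (K : V -> Prop) (q : V -> R) :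
  K 0 -> additive_on K q -> q 0 = 0.
Proof. by move=> K0 qD; have := qD _ _ K0 K0; rewrite addr0; lra. Qed.

Lemma additive_mono (phi : (E -> R) -> R) f g : additive_on pf phi -> nonneg_on pf phi ->
  pf f -> pf g -> fle f g -> phi f <= phi g.
Proof.
move=> pD p0 hf hg fg; have hr := pf_sub hg hf fg.
by rewrite -(subrK f g) pD // lerDr p0.
Qed.

Lemma fle_trans (f g h : E -> R) : fle f g -> fle g h -> fle f h.
Proof. by move=> fg gh x Cx; apply: le_trans (fg _ Cx) (gh _ Cx). Qed.

(* An approximate Hahn decomposition of [0, f] relative to mu: any g at which mu
   is within e of its supremum over [0, f] will do. *)
Lemma near_maximizer (mu : (E -> R) -> R) f (M e : R) : additive_on pf mu -> pf f ->
  (forall h, pf h -> fle h f -> mu h <= M) -> 0 < e ->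
  exists g, [/\ pf g, fle g f, forall h, pf h -> fle h g -> - e <= mu h &
    forall h, pf h -> fle h (f - g) -> mu h <= e].
Proof.
move=> muD hf muM e0.
pose S : set R := [set r | exists h, [/\ pf h, fle h f & r = mu h]].
have hS : has_sup S.
  split; last by exists M => _ [h [hh hhf ->]]; apply: muM.
  by exists (mu f), f; split.
have [_ [g [hg gf ->]] hge] := sup_adherent e0 hS.
(* Both g - h for h below g and g + h for h below f - g compete again in [0, f]. *)
exists g; split=> // h hh hhg.
  have hr := pf_sub hg hh hhg.
  have : mu (g - h) <= sup S.
    apply: sup_upper_bound => //; exists (g - h); split=> // x Cx.
    by rewrite !fctE; have := gf _ Cx; have [_ _ /(_ _ Cx)] := hh; lra.
  by move: hge; rewrite -{1}(subrK h g) muD //; lra.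
have : mu (g + h) <= sup S.
  apply: sup_upper_bound => //; exists (g + h); split=> //; first exact: pf_add.
  by move=> x Cx; rewrite !fctE; have := hhg _ Cx; rewrite !fctE; lra.
by rewrite muD //; lra.
Qed.

(** The pointwise supremum is additive because near-suprema at x and at y are both attained at the
    larger of the two indices. *)
Lemma pf_seq_sup (p : nat -> E -> R) f : pf f -> (forall k, pf (p k)) ->
  (forall k, fle (p k) (p k.+1)) -> (forall k, fle (p k) f) ->
  exists P, [/\ pf P, forall k, fle (p k) P &
    forall x r, C x -> (forall k, p k x <= r) -> P x <= r].
Proof.
move=> hf hp pS pF; have [[C0 CD _] _ _] := hC.
have pmon i j x : C x -> (i <= j)%N -> p i x <= p j x.
  move=> Cx; elim: j => [|j ih]; first by rewrite leqn0 => /eqP ->.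
  rewrite leq_eqVlt ltnS => /orP[/eqP -> //|/ih h].
  by apply: le_trans h (pS _ _ Cx).
pose S x : set R := [set r | exists k, r = p k x].
have hS x : C x -> has_sup (S x).
  move=> Cx; split; first by exists (p 0%N x), 0%N.
  by exists (f x) => _ [k ->]; apply: pF.
have ub k x : C x -> p k x <= sup (S x).
  by move=> Cx; apply: sup_upper_bound; [exact: hS | exists k].
have lub x r : C x -> (forall k, p k x <= r) -> sup (S x) <= r.
  by move=> Cx h; apply: ge_sup => [|_ [k ->]//]; case: (hS x Cx).
have [P [hP PE]] : exists P, pf P /\ forall x, C x -> P x = sup (S x).
  apply: (pf_extension hC) => [x y Cx Cy|x Cx]; last first.
    by apply: le_trans (ub 0%N x Cx); have [_ _] := hp 0%N; apply.
  apply/eqP; rewrite eq_le; apply/andP; split.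
    apply: lub => [|k]; first exact: CD.
    by have [-> _ _] := hp k; apply: lerD; apply: ub.
  apply/ler_addgt0Pr => e e0; have e2 : 0 < e / 2 by lra.
  have [_ [i ->] hi] := sup_adherent e2 (hS x Cx).
  have [_ [j ->] hj] := sup_adherent e2 (hS y Cy).
  have := ub (maxn i j) _ (CD _ _ Cx Cy); have [-> _ _] := hp (maxn i j).
  have := pmon _ _ x Cx (leq_maxl i j); have := pmon _ _ y Cy (leq_maxr i j).
  by lra.
exists P; split=> // [k x Cx|x r Cx h]; first by rewrite PE ?ub.
by rewrite PE ?lub.
Qed.

(** The finite joins increase and stay below f, and each is at most the corresponding partial sum,
    so the limit inherits every bound on the partial sums. *)
Lemma pf_countable_join (h : nat -> E -> R) f : pf f -> (forall k, pf (h k)) ->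
  (forall k, fle (h k) f) ->
  exists P, [/\ pf P, fle P f, forall k, fle (h k) P &
    forall x r, C x -> (forall n, \sum_(k < n) h k x <= r) -> P x <= r].
Proof.
move=> hf hh hhf.
have /choice[j hj] (fg : (E -> R) * (E -> R)) : exists j : E -> R,
    pf fg.1 -> pf fg.2 -> fle fg.1 f -> fle fg.2 f ->
    [/\ pf j, fle fg.1 j, fle fg.2 j, fle j f & fle j (fg.1 + fg.2)].
  have [[h1 h2 h3 h4]|nh] := pselect [/\ pf fg.1, pf fg.2, fle fg.1 f & fle fg.2 f].
    by have [j jP] := pf_join hC h1 h2 hf h3 h4; exists j.
  by exists 0 => h1 h2 h3 h4; exfalso; apply: nh.
pose p := fix p n := if n is m.+1 then j (p m, h m.+1) else h 0%N.
have hp n : pf (p n) /\ fle (p n) f.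
  elim: n => [|n [ih1 ih2]] //=.
  by have [] := hj (p n, h n.+1) ih1 (hh _) ih2 (hhf _).
have hpS n : [/\ fle (p n) (p n.+1), fle (h n.+1) (p n.+1) &
    fle (p n.+1) (p n + h n.+1)].
  have [ih1 ih2] := hp n.
  by have [] := hj (p n, h n.+1) ih1 (hh _) ih2 (hhf _).
have [P [hP pP Plub]] : exists P, [/\ pf P, forall k, fle (p k) P &
    forall x r, C x -> (forall k, p k x <= r) -> P x <= r].
  apply: (pf_seq_sup hf) => k; first by have [] := hp k.
    by have [] := hpS k.
  by have [] := hp k.
exists P; split=> // [x Cx|k|x r Cx hr].
- by apply: Plub => // k; have [_] := hp k; apply.
- apply: fle_trans (pP k); case: k => [|k] //.
  by have [] := hpS k.
(* The join [p k] involves h 0 up to h k, hence k + 1 summands. *)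
- apply: Plub => // k; apply: le_trans (hr k.+1).
  elim: k => [|k ih]; first by rewrite big_ord_recr big_ord0 /= add0r.
  rewrite big_ord_recr /=; have [_ _ /(_ _ Cx)] := hpS k.
  by rewrite fctE /=; lra.
Qed.

(** * Approximation of an order continuous functional by points of E *)

Section Normal.
Variables (phi : (E -> R) -> R).
Hypothesis hphi : normal phi.

Let phiD : additive_on pf phi. Proof. by case: hphi. Qed.
Let phi0 : nonneg_on pf phi. Proof. by case: hphi. Qed.

Lemma additive_on_sub_eval x (a : R) : additive_on pf (fun h => phi h - a * h x).
Proof. by move=> f g hf hg; rewrite phiD // fctE; lra. Qed.

(* These h form a downward directed set with infimum 0, to which the order
   continuity of phi applies. *)
Definition undominated f h := [/\ pf h, fle h f & forall e, 0 < e ->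
  exists2 u, C u & forall g, pf g -> fle g (f - h) -> phi g <= g u + e].

(** Since h1 + h2 - f lies below the meet m, f - m is at most (f - h1) + (f - h2). A functional
    below f - m therefore splits accordingly, and the two dominating points add up. *)
Lemma undominated_meet f h1 h2 : pf f -> undominated f h1 -> undominated f h2 ->
  exists h3, [/\ undominated f h3, fle h3 h1 & fle h3 h2].
Proof.
move=> hf [hh1 h1f H1] [hh2 h2f H2].
have [m [hm m1 m2 mglb _]] := pf_meet hC hh1 hh2.
exists m; split=> //; split=> //; first exact: fle_trans h1f.
move=> e e0; have e2 : 0 < e / 2 by lra.
have [u1 C1 {}H1] := H1 _ e2; have [u2 C2 {}H2] := H2 _ e2.
have [[C0 CD _] _ _] := hC.
exists (u1 + u2) => [|g hg gf]; first exact: CD.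
have [g1 [g2 [hg1 hg2 gE l1 l2]]] : exists g1 g2,
    [/\ pf g1, pf g2, g = g1 + g2, fle g1 (f - h1) & fle g2 (f - h2)].
  apply: (pf_split hC) => //; [exact: pf_sub | exact: pf_sub |].
  move=> x Cx; apply: le_trans (gf _ Cx) _; rewrite !fctE.
  have [[[fD _ _] [h1D _ _]] [h2D _ _]] := (hf, hh1, hh2).
  have : h1 x + h2 x - f x <= m x; last by lra.
  apply: (mglb (fun x => h1 x + h2 x - f x)) => // [y z|y Cy|y Cy].
  + by rewrite fD h1D h2D; lra.
  + by have := h2f _ Cy; lra.
  + by have := h1f _ Cy; lra.
have := H1 _ hg1 l1; have := H2 _ hg2 l2.
rewrite gE phiD // !fctE.
have [[D1 _ P1] [D2 _ P2]] := (hg1, hg2); rewrite D1 D2.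
by have := P1 _ C2; have := P2 _ C1; lra.
Qed.

(** Let h n be the part of f on which, up to [b n], phi exceeds evaluation at u / a n. As phi is at
    most K there, h n is small at u, and so is the join P of all h n. Off P, phi is dominated by u /
    a n up to [b n], for every n. *)
Lemma undominated_small f u (eta : R) : pf f -> C u -> 0 < eta ->
  exists h, undominated f h /\ h u <= eta.
Proof.
move=> hf Cu eta0; have [_ CZ _] := hC.
have K0 := phi0 hf; set K := phi f in K0.
(* The errors [b n] tend to 0 and sum to 1; [a n] is chosen such that h n (u) <= a n * (K + 1) = eta
   * b n. *)
pose b n : R := 2 ^- n.+1.
have b0 n : 0 < b n by rewrite invr_gt0 exprn_gt0.
have b1 n : b n <= 1 by rewrite invf_le1 ?exprn_gt0 // exprn_ege1 //; lra.
pose a n := eta * b n / (K + 1).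
have a0 n : 0 < a n by rewrite divr_gt0 ?mulr_gt0 //; lra.
have /choice[h hh] n : exists g, [/\ pf g, fle g f,
    forall h, pf h -> fle h g -> - b n <= phi h - (a n)^-1 * h u &
    forall h, pf h -> fle h (f - g) -> phi h - (a n)^-1 * h u <= b n].
  apply: (near_maximizer (M := K) (@additive_on_sub_eval u _)) => // g hg gf.
  have := additive_mono phiD phi0 hg hf gf.
  have : 0 <= (a n)^-1 * g u.
    by rewrite mulr_ge0 ?invr_ge0 ?(ltW (a0 n)) //; have [_ _] := hg; apply.
  by rewrite /K; lra.
have [P [hP Pf hP1 Plub]] : exists P, [/\ pf P, fle P f, forall k, fle (h k) P &
    forall x r, C x -> (forall n, \sum_(k < n) h k x <= r) -> P x <= r].
  by apply: pf_countable_join => // k; have [] := hh k.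
exists P; split.
  split=> // e e0.
  have [n hn] : exists n, b n <= e.
    have ie0 : 0 <= e^-1 by rewrite invr_ge0 ltW.
    have /ltW h1 := archi_boundP ie0; exists (Num.bound e^-1).
    rewrite /b invf_ple ?posrE ?exprn_gt0 //; apply: le_trans h1 _.
    rewrite -natrX ler_nat ltnW //; set N := Num.bound _.
    by apply: (leq_trans (ltn_expl N (isT : 1 < 2)%N)); rewrite leq_exp2l.
  have [hhn _ _ Hn] := hh n.
  exists ((a n)^-1 *: u) => [|g hg gf].
    by apply: CZ => //; rewrite invr_ge0 ltW.
  have : fle g (f - h n).
    by move=> x Cx; have := gf _ Cx; have := hP1 n _ Cx; rewrite !fctE; lra.
  by move=> /(Hn _ hg); have [_ -> _] := hg; lra.
apply: Plub => // n.
have hb k : h k u <= eta * b k.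
  have [hhk hkf /(_ _ hhk) Hk _] := hh k.
  have /Hk : fle (h k) (h k) by [].
  have := additive_mono phiD phi0 hhk hf hkf; rewrite -/K => l1 l2.
  have : (a k)^-1 * h k u <= K + 1 by have := b1 k; lra.
  rewrite ler_pdivrMl // /a mulrAC -mulrA divff ?mulr1 //.
  by apply: lt0r_neq0; lra.
have -> : eta = eta * 1 by rewrite mulr1.
apply: (@le_trans _ _ (eta * (1 - 2 ^- n))); last first.
  by rewrite ler_pM2l // lerBlDr lerDl invr_ge0 exprn_ge0.
elim: n => [|n ih]; first by rewrite big_ord0 expr0 invr1 subrr mulr0.
rewrite big_ord_recr /=; have := hb n; rewrite /b.
have e2 : 2 ^- n = 2 ^- n.+1 * 2 :> R by rewrite exprSr invfM mulrVK ?unitfE.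
by rewrite e2 in ih; lra.
Qed.

(** Order continuity yields an undominated h with phi h <= d / 2. The part of a functional below h
    costs at most d / 2, and the part below f - h is dominated by a point. *)
Lemma normal_dominated f (d : R) : pf f -> 0 < d ->
  exists2 u, C u & forall h, pf h -> fle h f -> phi h <= h u + d.
Proof.
move=> hf d0; have d2 : 0 < d / 2 by lra.
have [_ _ oc] := hphi; have [[C0 _ _] _ _] := hC.
have hff : fle f f by [].
(* The directed set is nonempty: only 0 lies between 0 and f - f. *)
have uff : undominated f f.
  split=> // e e0; exists 0 => // g hg gf.
  have -> : g = 0.
    apply: (pf_eq hC hg (pf0 C)) => x Cx; apply/eqP; rewrite eq_le.
    have [_ _ /(_ _ Cx) ->] := hg; rewrite andbT.
    by have := gf _ Cx; rewrite !fctE subrr.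
  by rewrite (additive_on0 (pf0 C) phiD) -[leRHS]/(0 + e) add0r ltW.
have [h [[hh hhf H] hd]] : exists h, undominated f h /\ phi h <= d / 2.
  apply: oc d2; first by exists f.
  - by move=> h [].
  - by move=> h1 h2; apply: undominated_meet.
  - by move=> x e Cx e0; apply: undominated_small.
have [u Cu Hu] := H _ d2; exists u => // g hg gf.
have [g1 [g2 [hg1 hg2 -> l1 l2]]] : exists g1 g2,
    [/\ pf g1, pf g2, g = g1 + g2, fle g1 h & fle g2 (f - h)].
  apply: (pf_split hC) => //; first exact: pf_sub.
  by rewrite addrC subrK.
rewrite phiD // fctE; have := Hu _ hg2 l2.
have := additive_mono phiD phi0 hg1 hh l1.
by have [_ _ /(_ _ Cu)] := hg1; lra.
Qed.

(* Correct x by a/2 times an element z of [-u, u] which is close to u where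
   phi > x and close to -u where phi < x. *)
Lemma halve_distance f u x (a d e : R) : pf f -> C u -> 0 <= a -> 0 < e ->
  (forall h, pf h -> fle h f -> `|phi h - h x| <= a * h u + d) ->
  exists x', forall h, pf h -> fle h f ->
    `|phi h - h x'| <= a / 2 * h u + (d + (3 + a) * e).
Proof.
move=> hf Cu a0 e0 H.
pose mu h := phi h - 1 * h x.
have muD : additive_on pf mu by apply: additive_on_sub_eval.
have muE h : phi h - h x = mu h by rewrite /mu mul1r.
have [g [hg gf Hg1 Hg2]] : exists g, [/\ pf g, fle g f,
    forall h, pf h -> fle h g -> - e <= mu h &
    forall h, pf h -> fle h (f - g) -> mu h <= e].
  apply: (near_maximizer (M := a * f u + d)) => // h hh hhf.
  have := H _ hh hhf; rewrite muE ler_norml => /andP[_ h1].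
  by apply: le_trans h1 _; rewrite lerD2r ler_wpM2l // hhf.
have hg' := pf_sub hf hg gf.
(* The two sides g and f - g of the decomposition may overlap. On their overlap m both estimates
   hold, so mu is within e of 0 there. *)
have [m [hm mg mg' mglb _]] := pf_meet hC hg hg'.
have [hc hc'] := (pf_sub hg hm mg, pf_sub hg' hm mg').
have [r [hr rc rc' _ radh]] := pf_meet hC hc hc'.
(* What is left of g and f - g after removing m is disjoint: r + m lies below both, hence below
   m. *)
have r0 : r u <= 0.
  have : (r + m) u <= m u; last by rewrite fctE; lra.
  have [rmD _ _] := pf_add hr hm.
  apply: mglb => // y Cy; first by have := rc _ Cy; rewrite !fctE; lra.
  by have := rc' _ Cy; rewrite !fctE; lra.
have [x1 [x2 [Cx1 Cx2 xu hx]]] := radh _ _ Cu e0.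
have cx1 : (g - m) x1 <= e by have [_ _ /(_ _ Cx2)] := hc'; lra.
have cx2 : (f - g - m) x2 <= e by have [_ _ /(_ _ Cx1)] := hc; lra.
(* Here x1 is nearly null for g - m and x2 for f - g - m, while x1 + x2 = u. So x2 - x1 acts like u
   below g - m and like - u below f - g - m; below m it is merely bounded by u. *)
exists (x + (a / 2) *: (x2 - x1)) => h hh hhf.
have [h1 [k1 [hh1 hk1 hE l1 lk1]]] : exists h1 k1,
    [/\ pf h1, pf k1, h = h1 + k1, fle h1 g & fle k1 (f - g)].
  by apply: (pf_split hC) => //; rewrite addrC subrK.
have [h2 [h3 [hh2 hh3 h23 l2 l3]]] : exists h2 h3,
    [/\ pf h2, pf h3, h1 = h2 + h3, fle h2 (g - m) & fle h3 m].
  by apply: (pf_split hC) => //; rewrite subrK.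
have [k2 [k3 [hk2 hk3 k23 lk2 lk3]]] : exists k2 k3,
    [/\ pf k2, pf k3, k1 = k2 + k3, fle k2 (f - g - m) & fle k3 m].
  by apply: (pf_split hC) => //; rewrite subrK.
have pos k y : pf k -> C y -> 0 <= k y by move=> [_ _ p] /p.
have lef k : pf k -> fle k g -> fle k f by move=> _ kg; apply: fle_trans gf.
have g'f : fle (f - g) f by move=> y Cy; rewrite fctE; have := pos _ _ hg Cy; rewrite !fctE; lra.
have lh2 : fle h2 g.
  by move=> y Cy; have := l2 _ Cy; have := pos _ _ hm Cy; rewrite !fctE; lra.
have lh3 : fle h3 g by apply: fle_trans l3 mg.
have lh3' : fle h3 (f - g) by apply: fle_trans l3 mg'.
have lk2' : fle k2 (f - g).
  by move=> y Cy; have := lk2 _ Cy; have := pos _ _ hm Cy; rewrite !fctE; lra.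
have lk3g : fle k3 g by apply: fle_trans lk3 mg.
have lk3' : fle k3 (f - g) by apply: fle_trans lk3 mg'.
have Hf k : pf k -> fle k f -> - (a * k u + d) <= mu k <= a * k u + d.
  by move=> hk kf; have := H _ hk kf; rewrite muE ler_norml.
have /andP[_ A1] := Hf _ hh2 (fle_trans lh2 gf).
have A2 := Hg1 _ hh2 lh2.
have /andP[B1 _] := Hf _ hk2 (fle_trans lk2' g'f).
have B2 := Hg2 _ hk2 lk2'.
have A3 := Hg1 _ hh3 lh3; have A4 := Hg2 _ hh3 lh3'.
have B3 := Hg1 _ hk3 lk3g; have B4 := Hg2 _ hk3 lk3'.
have zE k : pf k -> k (x + (a / 2) *: (x2 - x1)) =
    k x + (a / 2 * k u - a * k x1) /\ k (x + (a / 2) *: (x2 - x1)) =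
    k x - (a / 2 * k u - a * k x2).
  by move=> hk; have [kD kZ _] := hk; rewrite kD kZ (pfB hk) -xu kD; split; lra.
have hmu : phi h = phi h2 + phi h3 + (phi k2 + phi k3).
  by rewrite hE h23 k23 !phiD //; apply: pf_add.
have hu y : h y = h2 y + h3 y + (k2 y + k3 y) by rewrite hE h23 k23.
have [z1 z1'] := zE _ hh2; have [z2 z2'] := zE _ hk2.
have [z3 z3'] := zE _ hh3; have [z4 z4'] := zE _ hk3.
have M k y : pf k -> C y -> 0 <= a * k y by move=> hk Cy; rewrite mulr_ge0 ?pos.
have t1 : a * h2 x1 <= a * e by rewrite ler_wpM2l // (le_trans _ cx1) // l2.
have t2 : a * k2 x2 <= a * e by rewrite ler_wpM2l // (le_trans _ cx2) // lk2.
have Q1 := M _ _ hh2 Cx1; have Q2 := M _ _ hk2 Cx2.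
have Q3 := M _ _ hh3 Cx1; have Q4 := M _ _ hh3 Cx2.
have Q5 := M _ _ hk3 Cx1; have Q6 := M _ _ hk3 Cx2.
(* In each one-sided bound, one of h2 and k2 costs d + a * e and the other costs e; h3 and k3 below
   m cost e each. This gives d + (3 + a) * e. *)
rewrite hmu !hu ler_norml z1.
rewrite /mu in A1 A2 A3 A4 B1 B2 B3 B4.
set X := x + _ in z1 z2 z3 z4 z1' z2' z3' z4' *.
by apply/andP; split; lra.
Qed.

(* E is dense in L^1(f): the element x may depend on f and eps. *)
Lemma normal_approx f (e : R) : pf f -> 0 < e ->
  exists x, forall h, pf h -> fle h f -> `|phi h - h x| <= e.
Proof.
move=> hf e0; have e4 : 0 < e / 4 by lra.
have [u Cu Hu] := normal_dominated hf e4.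
have pos k y : pf k -> C y -> 0 <= k y by move=> [_ _ p] /p.
(* The slack d is quantified inside the induction, so that each halving can start from a smaller
   one; e / 4 is the error left by [normal_dominated]. *)
have iter n : forall d, e / 4 < d -> exists x, forall h, pf h -> fle h f ->
    `|phi h - h x| <= 2 ^- n * h u + d.
  elim: n => [|n ih] d hd.
    exists 0 => h hh hhf; rewrite expr0 invr1 mul1r.
    have -> : h 0 = 0 by have [hD _ _] := hh; have := hD 0 0; rewrite addr0; lra.
    rewrite subr0 ger0_norm ?phi0 //; have := Hu _ hh hhf; lra.
  have [|x hx] := ih ((d + e / 4) / 2); first by lra.
  (* As a = 2 ^- n is at most 1, the loss (3 + a) * d0 is at most (d - e / 4) / 2, the gap between
     the midpoint used above and d. *)
  have d0 : 0 < (d - e / 4) / 8 by lra.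
  have q0 : 0 <= 2 ^- n :> R by rewrite invr_ge0 exprn_ge0.
  have q1 : 2 ^- n <= 1 :> R by rewrite invf_le1 ?exprn_gt0 // exprn_ege1 //; lra.
  have [x' hx'] := halve_distance hf Cu q0 d0 hx.
  exists x' => h hh hhf; apply: le_trans (hx' _ hh hhf) _.
  have -> : 2 ^- n.+1 = 2 ^- n / 2 :> R by rewrite exprSr invfM.
  rewrite lerD2l.
  by have : 2 ^- n * ((d - e / 4) / 8) <= 1 * ((d - e / 4) / 8);
    [rewrite ler_wpM2r // ltW | lra].
have fu0 := pos _ _ hf Cu.
have q0 : 0 <= f u / (e / 4) by rewrite divr_ge0 // ltW.
have /ltW hN := archi_boundP q0; set N := Num.bound _ in hN.
have [|x hx] := iter N (e / 2); first by lra.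
exists x => h hh hhf; apply: le_trans (hx _ hh hhf) _.
have : 2 ^- N * h u <= e / 4; last by lra.
apply: (@le_trans _ _ (2 ^- N * f u)).
  by rewrite ler_wpM2l ?hhf // invr_ge0 exprn_ge0.
rewrite ler_pdivrMl ?exprn_gt0 // -ler_pdivrMr //.
apply: le_trans hN _; rewrite -natrX ler_nat ltnW //.
exact: ltn_expl.
Qed.

End Normal.

(** Evaluations at points commute with psi. Cutting psi down to its meet with evaluation at a
    suitable y confines the argument to the interval from 0 to B(., y), where phi is close to
    evaluation at one point x. *)
Lemma normal_exchange_le (phi psi : (E -> R) -> R) (B : E -> E -> R) f1 f2 :
  normal phi -> normal psi ->
  (forall x y z, B (x + y) z = B x z + B y z) ->
  (forall x, C x -> pf (B x)) -> (forall y, C y -> pf (B^~ y)) ->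
  pf f1 -> (forall y, C y -> f1 y = phi (B^~ y)) ->
  pf f2 -> (forall x, C x -> f2 x = psi (B x)) ->
  psi f1 <= phi f2.
Proof.
move=> nphi npsi BD B1 B2 hf1 f1E hf2 f2E.
have [phiD phi0 _] := nphi; have [psiD psi0 _] := npsi.
apply/ler_addgt0Pr => e' e'0; pose e := e' / 4.
have e0 : 0 < e by rewrite /e; lra.
have [y Cy Hy] := normal_dominated npsi hf1 e0.
have hR := pf_refinable hC.
have evD : additive_on pf (fun g => g y) by move=> g h _ _; rewrite fctE.
have ev0 : nonneg_on pf (fun g => g y) by move=> g [_ _]; apply.
(* The cut loses at most e at f1, because evaluation at y dominates psi on [0, f1] up to e. *)
pose psi' := inf_convolution pf psi (fun g => g y).
have psi'D : additive_on pf psi' by apply: inf_convolutionD.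
have psi'0 : nonneg_on pf psi' by apply: inf_convolution_ge0.
have psi'le g : pf g -> psi' g <= psi g by apply: inf_convolution_lel.
have psi'ev g : pf g -> psi' g <= g y by apply: inf_convolution_ler.
have psi'f1 : psi f1 <= psi' f1 + e.
  rewrite -lerBlDr; apply: le_inf_convolution => // g h hg hh gh.
  have hf : fle h f1.
    by move=> x Cx; rewrite -gh fctE lerDr; have [_ _] := hg; apply.
  have := Hy _ hh hf; rewrite -gh psiD //; lra.
have [f2' [hf2' f2'E]] : exists f, pf f /\ forall x, C x -> f x = psi' (B x).
  apply: (pf_extension hC) => [x z Cx Cz|x Cx]; last by apply: psi'0; apply: B1.
  rewrite -psi'D; [|exact: B1|exact: B1].
  by congr psi'; apply/funext => w; rewrite BD.
have f2'le : fle f2' f2 by move=> x Cx; rewrite f2'E // f2E // psi'le //; apply: B1.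
have f2'B : fle f2' (B^~ y) by move=> x Cx; rewrite f2'E // psi'ev //; apply: B1.
have [x hx] := normal_approx nphi (B2 _ Cy) e0.
have := additive_mono phiD phi0 hf2' hf2 f2'le.
have := hx _ hf2' f2'B; rewrite ler_norml => /andP[h1 _].
have [[C0 CD _] _ /(_ x)[p [n [Cp Cn xE]]]] := hC.
have f2'x : f2' x = psi' (B p) - psi' (B n) by rewrite xE (pfB hf2') !f2'E.
have hk1 := pf_add hf1 (B1 _ Cn).
(* The point x = p - n need not be positive, so that f1 is nearly B x is used in the form: f1 + B n
   is nearly below B p. *)
suff : psi' (f1 + B n) <= psi' (B p) + 2 * e.
  rewrite psi'D //; last exact: B1.
  rewrite /e in e0 h1 psi'f1 * => *; lra.
have [m [hm m1 m2 _ madh]] := pf_meet hC hk1 (B1 _ Cp).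
have [y1 [y2 [Cy1 Cy2 yE hy]]] := madh _ _ Cy e0.
have hr := pf_sub hk1 hm m1.
rewrite -(subrK m (f1 + B n)) psi'D //.
have := additive_mono psi'D psi'0 hm (B1 _ Cp) m2.
have h2 : psi' (f1 + B n - m) <= f1 y + B n y - m y := psi'ev _ hr.
have {}hy : f1 y1 + B n y1 + B p y2 <= m y + e := hy.
(* The excess of f1 + B n over its meet with B p, taken at y, is up to e its excess over B p at y2.
   There f1 is phi of B(., y2), and B(., y2) lies below B(., y). *)
suff : f1 y2 + B n y2 <= B p y2 + e.
  have [f1D _ _] := hf1; have [BnD _ _] := B1 _ Cn.
  by move: hy h2; rewrite -yE f1D BnD; lra.
have y2y : fle (B^~ y2) (B^~ y).
  move=> z Cz; rewrite -yE; have [-> _ p0] := B1 _ Cz.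
  by rewrite lerDr p0.
have := hx _ (B2 _ Cy2) y2y; rewrite -f1E // ler_norml => /andP[_].
by rewrite xE (pfB (B2 _ Cy2)); lra.
Qed.

Lemma normal_exchange (phi psi : (E -> R) -> R) (B : E -> E -> R) f1 f2 :
  normal phi -> normal psi ->
  (forall x y z, B (x + y) z = B x z + B y z) ->
  (forall x y z, B z (x + y) = B z x + B z y) ->
  (forall x, C x -> pf (B x)) -> (forall y, C y -> pf (B^~ y)) ->
  pf f1 -> (forall y, C y -> f1 y = phi (B^~ y)) ->
  pf f2 -> (forall x, C x -> f2 x = psi (B x)) ->
  psi f1 = phi f2.
Proof.
move=> nphi npsi BD BD' B1 B2 hf1 f1E hf2 f2E; apply/eqP; rewrite eq_le.
rewrite (normal_exchange_le nphi npsi BD B1 B2) //=.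
exact: (normal_exchange_le (B := fun x y => B y x) npsi nphi).
Qed.

End NormalFunctionals.

(** * Banach lattices *)

Section BanachLattices.
Variables (R : realType) (E : normedModType R) (le : E -> E -> Prop).
Hypothesis hE : is_banach_lattice le.

Let C := le 0.

Lemma bl_refl x : le x x. Proof. by have [h _] := hE. Qed.

Lemma bl_trans x y z : le x y -> le y z -> le x z.
Proof. by have [_ [_ [h _]]] := hE; apply: h. Qed.

Lemma bl_add x y z : le x y -> le (x + z) (y + z).
Proof. by have [_ [_ [_ [h _]]]] := hE; apply: h. Qed.

Lemma bl_scale (a : R) x : 0 <= a -> C x -> C (a *: x).
Proof.
have [_ [_ [_ [_ [h _]]]]] := hE => a0 x0.
by have := h _ _ _ a0 x0; rewrite scaler0.
Qed.

Lemma bl_sup x y : exists s, is_sup2 le x y s.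
Proof. by have [_ [_ [_ [_ [_ [h _]]]]]] := hE; apply: h. Qed.

Lemma bl_norm x y ax ay : is_sup2 le x (- x) ax -> is_sup2 le y (- y) ay ->
  le ax ay -> `|x| <= `|y|.
Proof. by have [_ [_ [_ [_ [_ [_ h]]]]]] := hE; apply: h. Qed.

Lemma bl_sub_ge0 x y : le x y -> C (y - x).
Proof. by move=> h; have := bl_add (- x) h; rewrite subrr. Qed.

Lemma bl_le_sub x y : C (y - x) -> le x y.
Proof. by move=> h; have := bl_add x h; rewrite subrK add0r. Qed.

Lemma bl_pos_add x y : C x -> C y -> C (x + y).
Proof.
move=> hx hy; apply: bl_trans hx _; apply: bl_le_sub.
by rewrite addrAC subrr add0r.
Qed.

Lemma bl_abs_pos x : C x -> is_sup2 le x (- x) x.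
Proof.
move=> hx; split; first exact: bl_refl.
split=> [|u hu _ //]; apply: bl_le_sub; rewrite opprK; exact: bl_pos_add.
Qed.

Lemma bl_abs_ge0 x ax : is_sup2 le x (- x) ax -> C ax.
Proof.
move=> [/bl_sub_ge0 h1 [/bl_sub_ge0 h2 _]].
have half : 0 <= 2^-1 :> R by rewrite invr_ge0.
have := bl_scale half (bl_pos_add h1 h2).
by rewrite opprK addrACA addNr addr0 -mulr2n -[ax *+ 2]scaler_nat scalerA mulVf // scale1r.
Qed.

Lemma bl_decomposition x : exists p n,
  [/\ C p, C n, x = p - n, `|p| <= `|x| & `|n| <= `|x|].
Proof.
have [p [xp [p0 plub]]] := bl_sup x 0.
have [ax hax] := bl_sup x (- x); have ax0 := bl_abs_ge0 hax.
have [xax [Nxax _]] := hax.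
have n0 : C (p - x) by apply: bl_sub_ge0.
exists p, (p - x); split=> //; first by rewrite opprB addrC subrK.
  by apply: bl_norm (bl_abs_pos p0) hax _; apply: plub.
apply: (bl_norm (bl_abs_pos n0) hax); apply: bl_le_sub.
rewrite opprB addrA; apply: bl_sub_ge0; apply: plub.
  by apply: bl_le_sub; rewrite addrK.
by have := bl_add x Nxax; rewrite addNr.
Qed.

(** If u is positive, then 0 and x both lie below x + |u - x|, so the negative part of x is at most
    |u - x| and its norm is at most that of u - x. *)
Lemma bl_cone_closed x :
  (forall e : R, 0 < e -> exists u, C u /\ `|u - x| <= e) -> C x.
Proof.
move=> h; have [p [xp [p0 plub]]] := bl_sup x 0.
have n0 : C (p - x) by apply: bl_sub_ge0.
suff : `|p - x| <= 0 by rewrite normr_le0 subr_eq0 => /eqP <-.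
apply/ler_addgt0Pr => e e0; rewrite add0r; have [u [u0 hu]] := h e e0.
apply: le_trans hu; have [ax hax] := bl_sup (u - x) (- (u - x)).
have ax0 := bl_abs_ge0 hax.
apply: (bl_norm (bl_abs_pos n0) hax); apply: bl_le_sub.
rewrite opprB addrA; apply: bl_sub_ge0; apply: plub.
  by apply: bl_le_sub; rewrite addrK.
have [/(bl_add x) ] := hax; rewrite subrK => h1 _.
exact: bl_trans u0 h1.
Qed.

Lemma bl_riesz_cone : riesz_cone C.
Proof.
split; last 2 first.
- by move=> a x; apply: bl_scale.
- by move=> x; have [p [n [hp hn -> _ _]]] := bl_decomposition x; exists p, n.
split; [exact: bl_refl | exact: bl_pos_add |].
move=> x y z w hx hy hz hw e; have [s [xs [zs slub]]] := bl_sup x z.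
(* The first piece x + z - s is the meet of x and z. *)
exists (x + z - s), (s - z), (s - x), (x + y - s); split; split.
- apply: bl_sub_ge0; apply: slub; apply: bl_le_sub; first by rewrite addrAC subrr add0r.
  by rewrite addrK.
- exact: bl_sub_ge0.
- exact: bl_sub_ge0.
- apply: bl_sub_ge0; apply: slub; apply: bl_le_sub; first by rewrite addrAC subrr add0r.
  by rewrite e addrAC subrr add0r.
- by rewrite addrA subrK addrK.
- by rewrite addrC addrA subrK addrAC subrr add0r.
- by rewrite addrA subrK addrAC subrr add0r.
- by rewrite e addrC addrA subrK addrAC subrr add0r.
Qed.

End BanachLattices.

(** X is the sum of the absolutely convergent series of the 2 ^- k *: u k; this is where
    completeness enters. Positivity passes to the limit because the cone is closed. *)
Lemma bl_dominating_sum (R : realType) (E : completeNormedModType R)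
    (le : E -> E -> Prop) (u : nat -> E) : is_banach_lattice le ->
  (forall k, le 0 (u k)) -> (forall k, `|u k| <= 1) ->
  exists X, le 0 X /\ forall k, le 0 (X - 2 ^- k *: u k).
Proof.
move=> hE u0 u1; pose v k := 2 ^- k *: u k.
have c0 k : 0 <= 2 ^- k :> R by rewrite invr_ge0 exprn_ge0.
have v0 k : le 0 (v k) by apply: (bl_scale hE).
have cv : cvgn (series v).
  apply: normed_cvg; apply: (@series_le_cvg _ _ (geometric 1 2^-1)).
  - by move=> n; rewrite normr_ge0.
  - by move=> n; rewrite /geometric /= mul1r exprVn.
  - move=> n; rewrite /geometric /= mul1r exprVn normrZ ger0_norm //.
    by rewrite ler_piMr.
  - by apply: is_cvg_geometric_series; rewrite ger0_norm ?invr_ge0 //; lra.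
pose X := limn (series v).
(* The strict inequality k < n ensures that v k occurs in the partial sum. *)
have near_sum (e : R) k : 0 < e -> exists2 n, (k < n)%N & `|series v n - X| <= e.
  move=> e0; have /cvgrPdist_le /(_ e e0) [N _ HN] := cv.
  exists (maxn N k.+1); first exact: leq_maxr.
  by rewrite distrC; apply: HN; rewrite /= leq_maxl.
have sum0 (P : pred nat) n : le 0 (\sum_(0 <= i < n | P i) v i).
  elim/big_ind: _ => //; first exact: (bl_refl hE).
  by move=> x y; apply: (bl_pos_add hE).
exists X; split=> [|k]; apply: (bl_cone_closed hE) => e e0.
  have [n _ hn] := near_sum e 0%N e0; exists (series v n); split=> //.
  exact: sum0.
have [n kn hn] := near_sum e k e0.
exists (series v n - v k); split; last by rewrite opprB addrA subrK.
rewrite seriesEnat /= (bigD1_seq k) /= ?mem_index_iota ?iota_uniq //.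
by rewrite addrAC subrr add0r; apply: sum0.
Qed.

(** * Multilinear forms *)

Section Tuples.
Variables (T : Type) (n : nat).
Implicit Types (v w : 'I_n -> T) (i j : 'I_n).

Lemma upd_at v i x : upd v i x i = x.
Proof. by rewrite /upd eqxx. Qed.

Lemma upd_ne v i j x : j != i -> upd v i x j = v j.
Proof. by rewrite /upd => /negPf ->. Qed.

Lemma upd_self v i : upd v i (v i) = v.
Proof. by apply/funext => j; rewrite /upd; case: eqP => // ->. Qed.

Lemma upd_upd v i x y : upd (upd v i x) i y = upd v i y.
Proof. by apply/funext => j; rewrite /upd; case: eqP. Qed.

Lemma upd_comm v i j x y : i != j -> upd (upd v i x) j y = upd (upd v j y) i x.
Proof.
move=> ij; apply/funext => k; rewrite /upd.
by case: (eqVneq k j) => [->|//]; rewrite eq_sym (negPf ij).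
Qed.

(** As s grows from the empty list to [enum 'I_n], v turns into w one [upd] at a time; this carries
    the inductions over the variables. *)
Definition mix (s : seq 'I_n) v w : 'I_n -> T := fun i => if i \in s then w i else v i.

Lemma mix_nil v w : mix [::] v w = v. Proof. by []. Qed.

Lemma mix_cons i s v w : mix (i :: s) v w = upd (mix s v w) i (w i).
Proof.
apply/funext => j; rewrite /mix /upd in_cons.
by case: eqP => [->|].
Qed.

Lemma mix_enum v w : mix (enum 'I_n) v w = w.
Proof. by apply/funext => j; rewrite /mix mem_enum. Qed.

Lemma mix_notin i s v w : i \notin s -> mix s v w i = v i.
Proof. by rewrite /mix => /negPf ->. Qed.

End Tuples.

Section MultilinearForms.
Variables (R : realType) (V : lmodType R) (n : nat).
Implicit Types (a b : ('I_n -> V) -> R) (v w : 'I_n -> V).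

Definition multilinear a :=
  (forall v i x y, a (upd v i (x + y)) = a (upd v i x) + a (upd v i y)) /\
  (forall v i (c : R) x, a (upd v i (c *: x)) = c * a (upd v i x)).

Lemma multilinearB a v i x y : multilinear a ->
  a (upd v i (x - y)) = a (upd v i x) - a (upd v i y).
Proof. by move=> [aD aZ]; rewrite aD -scaleN1r aZ mulN1r. Qed.

Lemma multilinear_scale a v (c : 'I_n -> R) : multilinear a ->
  a (fun i => c i *: v i) = (\prod_(i < n) c i) * a v.
Proof.
move=> [_ aZ]; set w := fun i => _.
have key s : uniq s -> a (mix s v w) = (\prod_(i <- s) c i) * a v.
  elim: s => [_|i s ih /= /andP[si us]]; first by rewrite mix_nil big_nil mul1r.
  rewrite mix_cons big_cons aZ.
  by rewrite -(mix_notin v w si) upd_self ih // mulrA.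
by have := key _ (enum_uniq 'I_n); rewrite mix_enum big_enum.
Qed.

Section Positive.
Variable C : V -> Prop.
Hypothesis hC : riesz_cone C.

Definition pos_form a := multilinear a /\ forall v, (forall i, C (v i)) -> 0 <= a v.

(** Every tuple arises from positive ones by taking differences in one variable after the other. *)
Lemma cone_tuple_ind (P : ('I_n -> V) -> Prop) :
  (forall v, (forall j, C (v j)) -> P v) ->
  (forall v j x y, P (upd v j x) -> P (upd v j y) -> P (upd v j (x - y))) ->
  forall v, P v.
Proof.
move=> Pc Pb v.
suff key (s : seq 'I_n) : forall v, (forall j, j \notin s -> C (v j)) -> P v.
  by apply: (key (enum 'I_n)) => j; rewrite mem_enum.
elim: s => [|i s ih] w hw; first by apply: Pc => j; apply: hw.
have [_ _ /(_ (w i)) [p [m [Cp Cm wE]]]] := hC.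
rewrite -(upd_self w i) wE; apply: Pb; apply: ih => j js; rewrite /upd;
  case: eqVneq => // ji; apply: hw; by rewrite in_cons (negPf ji).
Qed.

Lemma pos_form_eq a b : multilinear a -> multilinear b ->
  (forall v, (forall i, C (v i)) -> a v = b v) -> a = b.
Proof.
move=> ha hb ab; apply/funext; apply: cone_tuple_ind => // v j x y h1 h2.
by rewrite !multilinearB // h1 h2.
Qed.

Lemma pos_form_mono a v w : pos_form a -> (forall i, C (v i)) ->
  (forall i, C (w i - v i)) -> a v <= a w.
Proof.
move=> [[aD aZ] a0] v0 wv; have [[C0 CD _] _ _] := hC.
have w0 i : C (w i) by rewrite -(subrK (v i) (w i)); apply: CD.
suff key s : a v <= a (mix s v w) by rewrite -(mix_enum v w).
elim: s => [|i s ih] //; apply: le_trans ih _; set m := mix s v w.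
have m0 j : C (m j) by rewrite /m /mix; case: ifP.
rewrite mix_cons -/m -{1}(upd_self m i) -[w i](subrK (m i)) addrC aD lerDl.
apply: a0 => j; rewrite /upd; case: eqP => _; last exact: m0.
rewrite /m /mix.
by case: ifP => _ //; rewrite subrr.
Qed.

End Positive.

(* The t-linear coefficient of a form along the affine line v + t w. *)
Lemma multilinear_line a v w s : multilinear a -> uniq s -> exists q : {poly R},
  forall t : R, a (mix s v (fun i => v i + t *: w i)) =
    a v + t * (\sum_(i <- s) a (upd v i (w i))) + t ^+ 2 * q.[t].
Proof.
move=> [aD aZ]; elim: s v => [|i s ih] v.
  by exists 0 => t; rewrite mix_nil big_nil horner0; ring.
move=> /= /andP[si us]; have [q1 h1] := ih v us.
have [q2 h2] := ih (upd v i (w i)) us.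
exists (q1 + (\sum_(j <- s) a (upd (upd v i (w i)) j (w j)))%:P + 'X * q2) => t.
rewrite mix_cons aD aZ -[X in upd _ i X](mix_notin v (fun i => v i + t *: w i) si).
rewrite upd_self h1 big_cons.
have -> : upd (mix s v (fun j => v j + t *: w j)) i (w i) =
    mix s (upd v i (w i)) (fun j => upd v i (w i) j + t *: w j).
  apply/funext => j; rewrite /upd /mix; case: eqVneq => [->|//].
  by rewrite (negPf si).
by rewrite h2 !hornerE; ring.
Qed.

Lemma poly_identically0 (p : {poly R}) : (forall t, p.[t] = 0) -> p = 0.
Proof.
move=> p0; apply/eqP; apply/negPn/negP => np.
pose s : seq R := [seq i%:R | i <- iota 0 (size p)].
have us : uniq s by rewrite map_inj_uniq ?iota_uniq // => i j /eqP; rewrite eqr_nat => /eqP.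
have rs : all (root p) s by apply/allP => x _; rewrite /root p0.
by have := max_poly_roots np rs us; rewrite size_map size_iota ltnn.
Qed.

Definition symmetric_form a := forall v (s : 'S_n), a (fun j => v (s j)) = a v.

(** By induction on k, a vanishes on tuples that are constant from index k on. Putting x + t y into
    all these slots gives a polynomial in t that vanishes identically, and its linear coefficient is
    a positive multiple of the next value wanted. *)
Lemma polarization a : multilinear a -> symmetric_form a ->
  (forall x, a (fun _ => x) = 0) -> forall v, a v = 0.
Proof.
move=> ha asym adiag.
suff key k : (k <= n)%N -> forall v x, (forall i : 'I_n, (k <= i)%N -> v i = x) -> a v = 0.
  by move=> v; apply: (key n (leqnn n) v 0) => i; rewrite leqNgt ltn_ord.
elim: k => [_|k ih kn] v x hv.
  by rewrite -(adiag x); congr a; apply/funext => i; apply: hv.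
pose k0 := Ordinal kn; pose y := v k0.
pose s := [seq i : 'I_n <- enum 'I_n | (k <= i)%N].
have us : uniq s by rewrite filter_uniq // enum_uniq.
have sE (i : 'I_n) : (i \in s) = (k <= i)%N by rewrite mem_filter mem_enum andbT.
pose u := upd v k0 x.
have ux (i : 'I_n) : (k <= i)%N -> u i = x.
  move=> ki; rewrite /u /upd; case: eqVneq => // ne; apply: hv.
  by rewrite ltn_neqAle ki andbT; apply: contra ne => /eqP e; apply/eqP/val_inj.
have [q hq] := multilinear_line u (fun=> y) ha us.
set S := \sum_(i <- s) _ in hq.
have u0 : a u = 0 by apply: (ih (ltnW kn) u x).
have z t : t * S + t ^+ 2 * q.[t] = 0.
  rewrite -[LHS]add0r -{1}u0 addrA -hq; apply: (ih (ltnW kn) _ (x + t *: y)).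
  by move=> i ki; rewrite /mix sE ki ux.
have S0 : S = 0.
  have : 'X * S%:P + 'X^2 * q = 0.
    by apply: poly_identically0 => t; rewrite !hornerE z.
  move=> /(congr1 (fun p : {poly R} => p`_1)).
  by rewrite coefD coefXM coefC coefXnM /= coef0 addr0.
(* Each summand has y in one slot i and x in the other slots from k on; the transposition of i and
   k0 turns it into a v. *)
have Sv : S = (size s)%:R * a v.
  rewrite /S big_seq (eq_bigr (fun _ => a v)) => [|i].
    by rewrite -big_seq big_const_seq count_predT iter_addr_0 mulr_natl.
  rewrite sE => ki; rewrite -(asym v (tperm i k0)); congr a; apply/funext => j.
  rewrite /upd; case: eqVneq => [->|ji]; first by rewrite tpermL.
  have [jk|jk] := eqVneq j k0.
    rewrite jk tpermR /u upd_at hv // ltn_neqAle ki andbT.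
    by apply: contra ji => /eqP e; rewrite jk; apply/eqP/val_inj.
  by rewrite tpermD 1?eq_sym // /u upd_ne.
have sn0 : (size s)%:R != 0 :> R.
  rewrite pnatr_eq0 -lt0n; have : k0 \in s by rewrite sE.
  by case: (s).
by move/eqP: S0; rewrite Sv mulf_eq0 (negPf sn0) => /eqP.
Qed.

End MultilinearForms.

(** * Automatic continuity of positive multilinear maps *)

Section JointBound.
Variables (R : realType) (E G : completeNormedModType R).
Variables (leE : E -> E -> Prop) (leG : G -> G -> Prop).
Hypotheses (hE : is_banach_lattice leE) (hG : is_banach_lattice leG).
Variable n : nat.

(** A positive map into the dual of G, seen as a form with one more variable; boundedness is derived
    below. *)
Definition pos_map (A : ('I_n -> E) -> G -> R) :=
  [/\ forall g, multilinear (A^~ g),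
      forall v, (forall g h, A v (g + h) = A v g + A v h) /\
                (forall (c : R) g, A v (c *: g) = c * A v g) &
      forall v g, (forall i, leE 0 (v i)) -> leG 0 g -> 0 <= A v g].

Variable A : ('I_n -> E) -> G -> R.
Hypothesis hA : pos_map A.

Let cE := bl_riesz_cone hE.
Let cG := bl_riesz_cone hG.

Let A_form g : leG 0 g -> pos_form (leE 0) (A^~ g).
Proof. by move=> g0; have [h1 _ h3] := hA; split=> // v v0; apply: h3. Qed.

Let A_sub v g h : A v (g - h) = A v g - A v h.
Proof. by have [_ /(_ v)[gD gZ] _] := hA; rewrite gD -scaleN1r gZ mulN1r. Qed.

(* If A were unbounded on positive unit tuples, a weighted sum of tuples with
   fast growing values would dominate all of them at once. *)
Lemma unit_bound : exists M, forall v g, (forall i, leE 0 (v i)) -> leG 0 g ->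
  (forall i, `|v i| <= 1) -> `|g| <= 1 -> A v g <= M.
Proof.
have [Am AG A0] := hA; apply: contrapT => nM.
(* Weights 2 ^- k in the n variables of E and the one of G cost the factor (2 ^+ k) ^+ n * 2 ^+ k,
   so the value 2 ^+ k remains. *)
have /choice[p hp] (k : nat) : exists p : ('I_n -> E) * G,
    [/\ forall i, leE 0 (p.1 i), leG 0 p.2, forall i, `|p.1 i| <= 1, `|p.2| <= 1 &
      (2 ^+ k) ^+ n * 2 ^+ k * 2 ^+ k <= A p.1 p.2].
  apply: contrapT => np; apply: nM.
  exists ((2 ^+ k) ^+ n * 2 ^+ k * 2 ^+ k) => v g v0 g0 v1 g1.
  by rewrite leNgt; apply/negP => lt; apply: np; exists (v, g); split=> //; apply: ltW.
have /choice[X hX] (i : 'I_n) : exists X,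
    leE 0 X /\ forall k, leE 0 (X - 2 ^- k *: (p k).1 i).
  by apply: (bl_dominating_sum hE) => k; have [] := hp k.
have [Y [Y0 hY]] : exists Y, leG 0 Y /\ forall k, leG 0 (Y - 2 ^- k *: (p k).2).
  by apply: (bl_dominating_sum hG) => k; have [] := hp k.
have X0 i : leE 0 (X i) by have [] := hX i.
have key k : 2 ^+ k <= A X Y.
  have [v0 g0 _ _ big] := hp k.
  have c0 : 0 <= 2 ^- k :> R by rewrite invr_ge0 exprn_ge0.
  pose w i := 2 ^- k *: (p k).1 i.
  apply: (@le_trans _ _ (A w (2 ^- k *: (p k).2))); last first.
    apply: (@le_trans _ _ (A X (2 ^- k *: (p k).2))); last first.
      by rewrite -subr_ge0 -A_sub; apply: A0.
    apply: (pos_form_mono cE (A_form (bl_scale hG c0 g0))) => i.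
      exact: (bl_scale hE).
    by have [_] := hX i; apply.
  have [_ AZ] := AG w; rewrite AZ.
  rewrite (multilinear_scale (p k).1 (fun=> 2 ^- k) (Am _)) prodr_const card_ord.
  have k0 : 0 < 2 ^+ k :> R by rewrite exprn_gt0.
  have kn0 : 0 < (2 ^+ k) ^+ n :> R by rewrite exprn_gt0.
  rewrite exprVn mulrA -invfM mulrC ler_pdivlMr ?mulr_gt0 //.
  by apply: le_trans big; rewrite mulrCA [leRHS]mulrC [_ ^+ n * _]mulrC.
have /archi_boundP := A0 _ _ X0 Y0; apply/negP; rewrite -leNgt.
apply: le_trans (key (Num.bound (A X Y))).
by rewrite -natrX ler_nat ltnW // ltn_expl.
Qed.

Lemma pos_bound : exists2 M, 0 <= M & forall v g, (forall i, leE 0 (v i)) ->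
  leG 0 g -> A v g <= M * (\prod_(i < n) `|v i|) * `|g|.
Proof.
have [M0 hM] := unit_bound; have [Am AG A0] := hA.
exists (Num.max 0 M0) => [|v g v0 g0]; first by rewrite le_max lexx.
(* Zero entries are covered: the inverse of 0 is 0, and the rescaled entry is then 0. *)
have nv (W : completeNormedModType R) (x : W) : x = `|x| *: (`|x|^-1 *: x).
  have [->|x0] := eqVneq x 0; first by rewrite !scaler0.
  by rewrite scalerA divff ?scale1r // normr_eq0.
have n1 (W : completeNormedModType R) (x : W) : `|(`|x|^-1 *: x)| <= 1.
  rewrite normrZ ger0_norm ?invr_ge0 //.
  have [->|x0] := eqVneq x 0; first by rewrite normr0 mulr0.
  by rewrite mulVf ?normr_eq0.
have -> : A v g = \prod_(i < n) `|v i| * (`|g| *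
    A (fun i => `|v i|^-1 *: v i) (`|g|^-1 *: g)).
  rewrite {1}[g]nv; have [_ AZ] := AG v; rewrite AZ mulrCA; congr (_ * _).
  rewrite -(multilinear_scale (fun i => `|v i|^-1 *: v i) (fun i => `|v i|) (Am _)).
  by congr (A _ _); apply/funext => i; rewrite -nv.
set c := A _ _; rewrite mulrA mulrC -mulrA ler_wpM2r //.
  by rewrite mulr_ge0 // prodr_ge0.
rewrite le_max; apply/orP; right; apply: hM => //.
  by move=> i; apply: (bl_scale hE); rewrite ?invr_ge0.
  by apply: (bl_scale hG); rewrite ?invr_ge0.
  by move=> i; apply: n1.
exact: n1.
Qed.

(** Splitting an entry into positive and negative parts, neither larger in norm, doubles the bound;
    n entries and g give 2 ^+ n.+1. *)
Lemma joint_bound : exists M, forall v g,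
  `|A v g| <= M * (\prod_(i < n) `|v i|) * `|g|.
Proof.
have [M M0 hM] := pos_bound; have [Am AG A0] := hA.
have prod_mono v i x : `|x| <= `|v i| ->
    \prod_(j < n) `|upd v i x j| <= \prod_(j < n) `|v j|.
  move=> xv; apply: ler_prod => j _; rewrite normr_ge0 /upd /=.
  by case: eqP => [->|].
have half s : forall v g, (forall j, j \notin s -> leE 0 (v j)) -> leG 0 g ->
    `|A v g| <= 2 ^+ size s * M * (\prod_(i < n) `|v i|) * `|g|.
  elim: s => [|i s ih] v g hv g0.
    rewrite expr0 mul1r ger0_norm; first by apply: hM => // i; apply: hv.
    by apply: A0 => // i; apply: hv.
  have [p [m [p0 m0 vE pv mv]]] := bl_decomposition hE (v i).
  have ihx x : leE 0 x -> `|x| <= `|v i| ->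
      `|A (upd v i x) g| <= 2 ^+ size s * M * (\prod_(i < n) `|v i|) * `|g|.
    move=> x0 xv; apply: le_trans (ih _ _ _ g0) _.
      move=> j js; rewrite /upd; case: eqVneq => // ji.
      by apply: hv; rewrite in_cons (negPf ji).
    rewrite ler_wpM2r // ler_wpM2l ?prod_mono // mulr_ge0 // exprn_ge0 //.
  have -> : A v g = A (upd v i p) g - A (upd v i m) g.
    by rewrite -{1}(upd_self v i) vE; apply: (multilinearB v i p m (Am g)).
  apply: le_trans (ler_normB _ _) _.
  have := lerD (ihx _ p0 pv) (ihx _ m0 mv); rewrite /= exprS; lra.
exists (2 ^+ n.+1 * M) => v g.
have [p [m [p0 m0 gE pg mg]]] := bl_decomposition hG g.
have hx x : leG 0 x -> `|x| <= `|g| ->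
    `|A v x| <= 2 ^+ n * M * (\prod_(i < n) `|v i|) * `|g|.
  move=> x0 xg; apply: le_trans (half (enum 'I_n) _ _ _ x0) _.
    by move=> j; rewrite mem_enum.
  rewrite size_enum_ord ler_wpM2l // !mulr_ge0 // ?exprn_ge0 // prodr_ge0 //.
rewrite {1}gE A_sub; apply: le_trans (ler_normB _ _) _.
have := lerD (hx _ p0 pg) (hx _ m0 mg); rewrite exprS; lra.
Qed.

Lemma pos_map_dual v : is_dual_elem (A v).
Proof.
have [M hM] := joint_bound; have [_ /(_ v)[gD gZ] _] := hA.
split=> //; split=> //; exists (M * \prod_(i < n) `|v i|) => g; exact: hM.
Qed.

End JointBound.

Lemma pos_functional_dual (R : realType) (E : completeNormedModType R)
    (le : E -> E -> Prop) f : is_banach_lattice le ->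
  pos_functional (le 0) f -> is_dual_elem f.
Proof.
move=> hE [fD fZ f0].
(* A positive functional is a positive map with no vector variable whose last variable ranges over
   E. *)
apply: (pos_map_dual hE hE (n := 0) (A := fun _ => f)) => [|_]; last exact: 0.
split=> [g|//|v g _ g0]; last exact: f0.
by split=> v i; have := ltn_ord i.
Qed.

(** * Extension of forms along an isomorphism of duals *)

Section DualElements.
Variables (R : realType) (E : normedModType R).

Lemma dual_add (f g : E -> R) : is_dual_elem f -> is_dual_elem g -> is_dual_elem (f + g).
Proof.
move=> [fD [fZ [M fM]]] [gD [gZ [N gN]]]; split; last split.
- by move=> x y; rewrite !fctE fD gD addrACA.
- by move=> a x; rewrite !fctE fZ gZ mulrDr.
- exists (M + N) => x; rewrite fctE mulrDl.
  by apply: le_trans (ler_normD _ _) _; rewrite lerD.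
Qed.

Lemma dual_scale (c : R) (f : E -> R) : is_dual_elem f ->
  is_dual_elem (fun x => c * f x).
Proof.
move=> [fD [fZ [M fM]]]; split; last split.
- by move=> x y; rewrite fD mulrDr.
- by move=> a x; rewrite fZ mulrCA.
- exists (`|c| * M) => x; rewrite normrM -mulrA.
  by rewrite ler_wpM2l.
Qed.

Lemma dual_sub (f g : E -> R) : is_dual_elem f -> is_dual_elem g -> is_dual_elem (f - g).
Proof.
move=> hf hg; have -> : f - g = f + (fun x => -1 * g x).
  by apply/funext => x; rewrite !fctE mulN1r.
by apply: dual_add => //; apply: dual_scale.
Qed.

End DualElements.

Section DualIsomorphism.
Variables (R : realType) (E F : completeNormedModType R).
Variables (leE : E -> E -> Prop) (leF : F -> F -> Prop).
Hypotheses (hE : is_banach_lattice leE) (hF : is_banach_lattice leF).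
Variable T : (E -> R) -> (F -> R).
Hypothesis hT : dual_lattice_iso leE leF T.

Let cE := bl_riesz_cone hE.
Let cF := bl_riesz_cone hF.

Lemma dual_iso_dual f : is_dual_elem f -> is_dual_elem (T f).
Proof. by case: hT => h _; apply: h. Qed.

Lemma dual_isoD f g : is_dual_elem f -> is_dual_elem g -> T (f + g) = T f + T g.
Proof. by move=> hf hg; have [_ [h _]] := hT; apply: (h f g). Qed.

Lemma dual_isoZ c f : is_dual_elem f -> T (fun x => c * f x) = (fun y => c * T f y).
Proof. by move=> hf; have [_ [_ [h _]]] := hT; apply: h. Qed.

Lemma dual_isoB f g : is_dual_elem f -> is_dual_elem g -> T (f - g) = T f - T g.
Proof.
move=> hf hg; have <- : f + (fun x => -1 * g x) = f - g.
  by apply/funext => x; rewrite !fctE mulN1r.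
rewrite dual_isoD //; last exact: dual_scale.
by rewrite dual_isoZ //; apply/funext => x; rewrite !fctE mulN1r.
Qed.

Lemma dual_iso_pos f : pos_functional (leE 0) f -> pos_functional (leF 0) (T f).
Proof.
move=> hf; have df := pos_functional_dual hE hf.
have [TD [TZ _]] := dual_iso_dual df.
have [_ [_ [_ [_ [_ [h _]]]]]] := hT.
by split=> // y y0; apply: (h f df) => // x x0; have [_ _] := hf; apply.
Qed.

(* Infima of downward directed sets of functionals are computed pointwise on the
   positive cone and are preserved by T, because T is an order isomorphism. *)
Lemma dual_iso_normal y : leF 0 y -> normal (leE 0) (fun f => T f y).
Proof.
move=> y0; have [_ [_ [_ [_ [Tsurj [_ Trefl]]]]]] := hT.
have dE f : pos_functional (leE 0) f -> is_dual_elem f by apply: pos_functional_dual.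
split.
- by move=> f g hf hg; rewrite dual_isoD //; apply: dE.
- by move=> f hf; have [_ _] := dual_iso_pos hf; apply.
move=> D [h0 Dh0] Dpf Ddir Dinf e e0.
pose S z : set R := [set r | exists2 h, D h & r = T h z].
have Tpos h z : D h -> leF 0 z -> 0 <= T h z.
  by move=> Dh z0; have [_ _] := dual_iso_pos (Dpf _ Dh); apply.
have hS z : leF 0 z -> has_inf (S z).
  move=> z0; split; first by exists (T h0 z), h0.
  by exists 0 => _ [h Dh ->]; apply: Tpos.
have lb z h : leF 0 z -> D h -> inf (S z) <= T h z.
  by move=> z0 Dh; apply: ge_inf; [have [] := hS z z0 | exists h].
have Tmono h h' z : D h -> D h' -> fle (leE 0) h h' -> leF 0 z -> T h z <= T h' z.
  move=> Dh Dh' hh' z0; rewrite -subr_ge0.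
  have hs := pf_sub (Dpf _ Dh') (Dpf _ Dh) hh'.
  have : 0 <= T (h' - h) z by have [_ _] := dual_iso_pos hs; apply.
  by rewrite dual_isoB //; apply: dE; apply: Dpf.
have [[F0 FD _] _ _] := cF.
(* The pointwise infimum of the T h is additive on the cone because the family is directed. *)
have [k [hk kE]] : exists k, pos_functional (leF 0) k /\
    forall z, leF 0 z -> k z = inf (S z).
  apply: (pf_extension cF) => [z w z0 w0|z z0]; last first.
    apply: lb_le_inf; first by have [] := hS z z0.
    by move=> _ [h Dh ->]; apply: Tpos.
  apply/eqP; rewrite eq_le; apply/andP; split.
    apply/ler_addgt0Pr => d d0; have d2 : 0 < d / 2 by lra.
    have [_ [h Dh ->] hz] := inf_adherent d2 (hS z z0).
    have [_ [h' Dh' ->] hw] := inf_adherent d2 (hS w w0).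
    have [g [Dg gh gh']] := Ddir _ _ Dh Dh'.
    have := Tmono _ _ z Dg Dh gh z0; have := Tmono _ _ w Dg Dh' gh' w0.
    have := lb _ _ (FD _ _ z0 w0) Dg.
    by have [-> _ _] := dual_iso_pos (Dpf _ Dg); lra.
  apply: lb_le_inf; first by have [] := hS _ (FD _ _ z0 w0).
  move=> _ [h Dh ->]; have [-> _ _] := dual_iso_pos (Dpf _ Dh).
  by rewrite lerD // lb.
have [g dg gk] := Tsurj k (pos_functional_dual hF hk).
have g0 : pos_functional (leE 0) g.
  have [gD [gZ _]] := dg; split=> // x x0.
  by apply: (Trefl g dg) => // z z0; rewrite gk; have [_ _] := hk; apply.
(* Since T g = k <= T h and T reflects the order, g <= h for every h in D, whose pointwise infimum
   is 0. *)
have gz : g = 0.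
  apply: (pf_eq cE g0 (pf0 _)) => x x0; apply/eqP.
  rewrite eq_le; apply/andP; split; last by have [_ _] := g0; apply.
  apply/ler_addgt0Pr => d d0; rewrite -[leRHS]/(0 + d) add0r.
  have [h [Dh hd]] := Dinf x d x0 d0; apply: le_trans hd.
  rewrite -subr_ge0; have dh := dE _ (Dpf _ Dh).
  apply: (Trefl (h - g) (dual_sub dh dg) _ x x0) => z z0.
  by rewrite dual_isoB // gk !fctE subr_ge0 kE ?lb.
have T0 : T 0 y = 0.
  have d0 := dE _ (pf0 (leE 0)).
  by have := congr1 (@^~ y) (dual_isoB d0 d0); rewrite subrr fctE subrr.
have [_ [h Dh ->] hy] := inf_adherent e0 (hS y y0).
exists h; split=> //; rewrite -kE // -gk gz T0 add0r in hy.
exact: ltW.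
Qed.

(* V stands for E * F: a multilinear form on V accommodates forms in which some
   variables range over E and the others over F, as arise halfway through the
   extension. *)
Section FormExtension.
Variables (V : lmodType R) (K : V -> Prop) (n : nat).
Hypothesis hK : riesz_cone K.
Variables (emb : E -> V) (prj : V -> F).
Hypotheses (embD : forall x y, emb (x + y) = emb x + emb y)
  (embZ : forall (c : R) x, emb (c *: x) = c *: emb x)
  (emb0 : forall x, leE 0 x -> K (emb x)).
Hypotheses (prjD : forall v w, prj (v + w) = prj v + prj w)
  (prjZ : forall (c : R) v, prj (c *: v) = c *: prj v)
  (prj0 : forall v, K v -> leF 0 (prj v)).
Implicit Types (a b : ('I_n -> V) -> R) (v w : 'I_n -> V).

Definition slice a v i : E -> R := fun x => a (upd v i (emb x)).

(** One Arens step: the result depends on entry i through [prj] only, and the other entries keep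
    their role. *)
Definition transport_at i a : ('I_n -> V) -> R := fun v => T (slice a v i) (prj (v i)).

Definition transport (s : seq 'I_n) a := foldr transport_at a s.

Definition reg_form a := exists a1 a2, [/\ pos_form K a1, pos_form K a2 & a = a1 - a2].

Lemma slice_pf a v i : pos_form K a -> (forall j, j != i -> K (v j)) ->
  pos_functional (leE 0) (slice a v i).
Proof.
move=> [[aD aZ] a0] v0; split=> [x y|c x|x x0]; rewrite /slice.
- by rewrite embD aD.
- by rewrite embZ aZ.
- by apply: a0 => j; rewrite /upd; case: eqVneq => [_|/v0//]; apply: emb0.
Qed.

Lemma slice_upd_same a v i z : slice a (upd v i z) i = slice a v i.
Proof. by apply/funext => x; rewrite /slice upd_upd. Qed.

Lemma slice_updD a v i j y z : multilinear a -> j != i ->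
  slice a (upd v j (y + z)) i = slice a (upd v j y) i + slice a (upd v j z) i.
Proof.
move=> [aD _] ji; apply/funext => x; rewrite fctE /slice.
by rewrite !(upd_comm _ _ _ ji) aD.
Qed.

Lemma slice_updZ a v i j c z : multilinear a -> j != i ->
  slice a (upd v j (c *: z)) i = (fun x => c * slice a (upd v j z) i x).
Proof.
move=> [_ aZ] ji; apply/funext => x; rewrite /slice.
by rewrite !(upd_comm _ _ _ ji) aZ.
Qed.

(** At positive entries the slice is a positive functional, hence bounded; general entries are
    reached by differences. *)
Lemma slice_dual a v i : pos_form K a -> is_dual_elem (slice a v i).
Proof.
move=> ha; move: v; apply: (cone_tuple_ind hK) => [v v0|v j x y hx hy].
  by apply: (pos_functional_dual hE); apply: slice_pf => // j _; apply: v0.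
have [am _] := ha.
have [ji|ji] := eqVneq j i; first by move: hx; rewrite ji !slice_upd_same.
suff -> : slice a (upd v j (x - y)) i = slice a (upd v j x) i - slice a (upd v j y) i.
  exact: dual_sub.
apply/funext => z; rewrite !fctE /slice !(upd_comm _ _ _ ji); exact: multilinearB.
Qed.

Lemma reg_slice_dual a v i : reg_form a -> is_dual_elem (slice a v i).
Proof.
move=> [a1 [a2 [h1 h2 ->]]].
exact: dual_sub (slice_dual v i h1) (slice_dual v i h2).
Qed.

Lemma transport_at_pos i a : pos_form K a -> pos_form K (transport_at i a).
Proof.
move=> ha; have [am a0] := ha; have sd v := slice_dual v i ha.
split; last first.
  move=> v v0; have hs : pos_functional (leE 0) (slice a v i) by apply: slice_pf.
  by have [_ _] := dual_iso_pos hs; apply; apply: prj0.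
split=> [v j x y|v j c x]; rewrite /transport_at; have [->|ji] := eqVneq j i.
- rewrite !slice_upd_same !upd_at prjD.
  by have [-> _] := dual_iso_dual (sd v).
- by rewrite slice_updD // dual_isoD // !upd_ne // eq_sym.
- rewrite !slice_upd_same !upd_at prjZ.
  by have [_ [-> _]] := dual_iso_dual (sd v).
- by rewrite slice_updZ // dual_isoZ // !upd_ne // eq_sym.
Qed.

Lemma transport_at_sub i a b : reg_form a -> reg_form b ->
  transport_at i (a - b) = transport_at i a - transport_at i b.
Proof.
move=> ha hb; apply/funext => v; rewrite !fctE /transport_at.
rewrite -[T (slice a v i) _ - _]/((T (slice a v i) - T (slice b v i)) (prj (v i))).
by rewrite -dual_isoB //; apply: reg_slice_dual.
Qed.

Lemma pos_form0 : pos_form K (0 : ('I_n -> V) -> R).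
Proof.
split=> //; split=> [v i x y|v i c x]; rewrite -![(0 : ('I_n -> V) -> R) _]/0.
  by rewrite addr0.
by rewrite mulr0.
Qed.

Lemma pos_reg a : pos_form K a -> reg_form a.
Proof. by move=> ha; exists a, 0; split; rewrite ?subr0 //; apply: pos_form0. Qed.

Lemma regN a : reg_form a -> reg_form (- a).
Proof. by move=> [a1 [a2 [h1 h2 ->]]]; exists a2, a1; rewrite opprB. Qed.

Lemma transport_at_reg i a : reg_form a -> reg_form (transport_at i a).
Proof.
move=> [a1 [a2 [h1 h2 ->]]]; rewrite transport_at_sub; try exact: pos_reg.
by exists (transport_at i a1), (transport_at i a2); split=> //; apply: transport_at_pos.
Qed.

Lemma transport_at_scale i c a : reg_form a ->
  transport_at i (fun v => c * a v) = (fun v => c * transport_at i a v).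
Proof.
move=> ha; apply/funext => v; rewrite /transport_at.
rewrite -[RHS]/((fun y => c * T (slice a v i) y) (prj (v i))) -dual_isoZ //.
exact: reg_slice_dual.
Qed.

Lemma transport_pos s a : pos_form K a -> pos_form K (transport s a).
Proof. by move=> ha; elim: s => //= i s; apply: transport_at_pos. Qed.

Lemma transport_reg s a : reg_form a -> reg_form (transport s a).
Proof. by move=> ha; elim: s => //= i s; apply: transport_at_reg. Qed.

Lemma transport_sub s a b : reg_form a -> reg_form b ->
  transport s (a - b) = transport s a - transport s b.
Proof.
move=> ha hb; elim: s => //= i s ->.
by rewrite transport_at_sub //; apply: transport_reg.
Qed.

Lemma transport_add s a b : reg_form a -> reg_form b ->
  transport s (a + b) = transport s a + transport s b.
Proof.
move=> ha hb; rewrite -{1}[b]opprK transport_sub //; last exact: regN.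
have r0 := pos_reg pos_form0.
rewrite -[- b]sub0r transport_sub // opprB.
suff -> : transport s 0 = 0 by rewrite subr0.
by rewrite -(subrr (0 : ('I_n -> V) -> R)) transport_sub // !subrr.
Qed.

Lemma transport_scale s c a : reg_form a ->
  transport s (fun v => c * a v) = (fun v => c * transport s a v).
Proof.
move=> ha; elim: s => //= i s ->; rewrite transport_at_scale //.
exact: transport_reg.
Qed.

(** On positive tuples, fixing the other entries leaves a positive bilinear form on E, to which
    [normal_exchange] applies with the order continuous functionals given by the projections of v i
    and v j. *)
Lemma transport_at_comm i j a : pos_form K a ->
  transport_at i (transport_at j a) = transport_at j (transport_at i a).
Proof.
move=> ha; have [->//|ij] := eqVneq i j.
apply: (pos_form_eq hK).
- by have [] := transport_at_pos i (transport_at_pos j ha).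
- by have [] := transport_at_pos j (transport_at_pos i ha).
move=> v v0; have [[aD aZ] a0] := ha; rewrite /transport_at.
pose B x x' := a (upd (upd v i (emb x)) j (emb x')).
have v2 k z : K z -> forall l, K (upd v k z l).
  by move=> hz l; rewrite /upd; case: eqP.
apply: (@normal_exchange _ _ _ cE (fun f => T f (prj (v j)))
  (fun f => T f (prj (v i))) (fun x' x => B x x')).
- exact/dual_iso_normal/prj0.
- exact/dual_iso_normal/prj0.
- by move=> x y z; rewrite /B embD aD.
- by move=> x y z; rewrite /B embD !(upd_comm v _ _ ij) !aD.
- move=> x' x'0; rewrite (_ : (fun x => B x x') = slice a (upd v j (emb x')) i).
    by apply: slice_pf => // k _; apply/v2/emb0.
  by apply/funext => x; rewrite /B /slice upd_comm.
- by move=> x x0; apply: (slice_pf (v := upd v i (emb x))) => // k _; apply/v2/emb0.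
- exact: (slice_pf (transport_at_pos j ha)).
- move=> x x0; rewrite /slice /transport_at upd_ne 1?eq_sym //.
- exact: (slice_pf (transport_at_pos i ha)).
- move=> x x0; rewrite /slice /transport_at upd_ne //.
  by congr (T _ _); apply/funext => x'; rewrite /B (upd_comm _ _ _ ij).
Qed.

Lemma transport_perm s t a : pos_form K a -> perm_eq s t ->
  transport s a = transport t a.
Proof.
move=> ha; elim: s t => [|i s ih] t st.
  by move: st; rewrite perm_sym => /perm_nilP ->.
have it : i \in t by rewrite -(perm_mem st) mem_head.
case/splitPr: it st => t1 t2 st.
have {}st : perm_eq s (t1 ++ t2).
  by rewrite -(perm_cons i); apply: perm_trans st _; rewrite -cat1s perm_catCA.
rewrite /= (ih _ st); elim: t1 {st ih} => //= k t1 <-.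
by rewrite transport_at_comm //; apply: transport_pos.
Qed.

(** Permuting the arguments amounts to transporting the variables in a permuted order, and the order
    is irrelevant by [transport_perm]. *)
Lemma transport_symmetric a : pos_form K a -> symmetric_form a ->
  symmetric_form (transport (enum 'I_n) a).
Proof.
move=> ha asym v p.
have key s : transport s a v = transport [seq p^-1%g i | i <- s] a (fun j => v (p j)).
  elim: s v => [|i s ih] v; first by rewrite /= asym.
  rewrite /= /transport_at permKV; congr (T _ _); apply/funext => x.
  rewrite /slice ih; congr (transport _ a _); apply/funext => j.
  by rewrite /upd (can2_eq (permK p) (permKV p)).
rewrite [RHS]key; congr (_ _); apply: transport_perm => //.
apply: uniq_perm; rewrite ?enum_uniq //.
  by rewrite map_inj_uniq ?enum_uniq //; apply: perm_inj.
move=> i; rewrite mem_enum; apply/esym/mapP.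
by exists (p i); rewrite ?mem_enum // permK.
Qed.

(** * Extension of maps with values in the dual of G *)

Section MapExtension.
Variables (G : completeNormedModType R) (leG : G -> G -> Prop).
Hypothesis hG : is_banach_lattice leG.
Variables (base : V -> E) (lift : F -> V).
Hypotheses (baseD : forall x y, base (x + y) = base x + base y)
  (baseZ : forall (c : R) x, base (c *: x) = c *: base x)
  (base0 : forall x, K x -> leE 0 (base x)).
Hypotheses (liftD : forall x y, lift (x + y) = lift x + lift y)
  (liftZ : forall (c : R) x, lift (c *: x) = c *: lift x)
  (lift0 : forall y, leF 0 y -> K (lift y)).
Implicit Types (A B : ('I_n -> E) -> G -> R).

Definition symmetric_map (W : Type) (A : ('I_n -> W) -> G -> R) :=
  forall (u : 'I_n -> W) (s : 'S_n), A (fun j => u (s j)) = A u.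

Definition base_form A g : ('I_n -> V) -> R := fun v => A (fun i => base (v i)) g.

Definition extend A : ('I_n -> F) -> G -> R :=
  fun y g => transport (enum 'I_n) (base_form A g) (fun i => lift (y i)).

Lemma comp_upd (W W' : Type) (f : W -> W') (v : 'I_n -> W) i x :
  (fun j => f (upd v i x j)) = upd (fun j => f (v j)) i (f x).
Proof. by apply/funext => j; rewrite /upd; case: eqP. Qed.

Lemma base_form_pos A g : pos_map leE leG A -> leG 0 g -> pos_form K (base_form A g).
Proof.
move=> [Am _ A0] g0; split=> [|v v0]; last by apply: A0 => // i; apply: base0.
have [AD AZ] := Am g.
split=> [v i x y|v i c x]; rewrite /base_form !comp_upd.
  by rewrite baseD; apply: AD.
by rewrite baseZ; apply: AZ.
Qed.

Lemma base_form_reg A g : pos_map leE leG A -> reg_form (base_form A g).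
Proof.
move=> hA; have [p [m [p0 m0 -> _ _]]] := bl_decomposition hG g.
exists (base_form A p), (base_form A m); split; try exact: base_form_pos.
have [_ AG _] := hA; apply/funext => v; rewrite !fctE /base_form.
by have [gD gZ] := AG (fun i => base (v i)); rewrite gD -scaleN1r gZ mulN1r.
Qed.

Lemma extend_pos_map A : pos_map leE leG A -> pos_map leF leG (extend A).
Proof.
move=> hA; have reg g := base_form_reg g hA.
have Am g : multilinear (transport (enum 'I_n) (base_form A g)).
  have [a1 [a2 [[[h1D h1Z] _] [[h2D h2Z] _] ->]]] := transport_reg (enum 'I_n) (reg g).
  split=> [v i x y|v i c x]; rewrite !fctE ?h1D ?h2D ?h1Z ?h2Z; lra.
split.
- move=> g; have [AD AZ] := Am g.
  split=> [v i x y|v i c x]; rewrite /extend !comp_upd ?liftD ?liftZ ?AD ?AZ //.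
- move=> y; have [_ AG _] := hA; split=> [g h|c g]; rewrite /extend.
    rewrite (_ : base_form A (g + h) = base_form A g + base_form A h).
      by rewrite transport_add.
    by apply/funext => v; rewrite fctE /base_form; have [-> _] := AG (fun i => base (v i)).
  rewrite (_ : base_form A (c *: g) = fun v => c * base_form A g v).
    by rewrite transport_scale.
  by apply/funext => v; rewrite /base_form; have [_ ->] := AG (fun i => base (v i)).
- move=> y g y0 g0; have [_] := transport_pos (enum 'I_n) (base_form_pos hA g0).
  by apply=> i; apply: lift0.
Qed.

Lemma extend_symmetric A : pos_map leE leG A -> symmetric_map A ->
  symmetric_map (extend A).
Proof.
move=> hA As y s; apply/funext => g; rewrite /extend.
have [p [m [p0 m0 gE _ _]]] := bl_decomposition hG g.
have -> : base_form A g = base_form A p - base_form A m.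
  apply/funext => v; rewrite !fctE /base_form gE; have [_ AG _] := hA.
  by have [gD gZ] := AG (fun i => base (v i)); rewrite gD -scaleN1r gZ mulN1r.
have sym h : symmetric_form (base_form A h).
  by move=> v t; rewrite /base_form (As (fun i => base (v i)) t).
rewrite transport_sub; try exact: base_form_reg.
rewrite !fctE; congr (_ - _).
  exact: (transport_symmetric (base_form_pos hA p0) (sym p) (fun i => lift (y i)) s).
exact: (transport_symmetric (base_form_pos hA m0) (sym m) (fun i => lift (y i)) s).
Qed.

Lemma extend_add A B : pos_map leE leG A -> pos_map leE leG B ->
  extend (fun x g => A x g + B x g) = (fun y g => extend A y g + extend B y g).
Proof.
move=> hA hB; apply/funext => y; apply/funext => g; rewrite /extend.
rewrite (_ : base_form _ g = base_form A g + base_form B g) //.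
by rewrite transport_add //; apply: base_form_reg.
Qed.

Lemma extend_scale (c : R) A : pos_map leE leG A ->
  extend (fun x g => c * A x g) = (fun y g => c * extend A y g).
Proof.
move=> hA; apply/funext => y; apply/funext => g; rewrite /extend.
rewrite (_ : base_form _ g = fun v => c * base_form A g v) //.
by rewrite transport_scale //; apply: base_form_reg.
Qed.

End MapExtension.

End FormExtension.
End DualIsomorphism.

Lemma dual_lattice_iso_inverse (R : realType) (E F : normedModType R)
    (leE : E -> E -> Prop) (leF : F -> F -> Prop) T : dual_lattice_iso leE leF T ->
  exists S, [/\ dual_lattice_iso leF leE S, forall f, is_dual_elem f -> S (T f) = f &
    forall g, is_dual_elem g -> T (S g) = g].
Proof.
move=> [Td [TD [TZ [Tinj [Tsurj [Tpos Trefl]]]]]].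
(* Outside the dual of F the inverse takes the value 0. *)
have /choice[S hS] (g : F -> R) : exists f, is_dual_elem g -> is_dual_elem f /\ T f = g.
  have [dg|ndg] := pselect (is_dual_elem g); last by exists (fun=> 0).
  by have [f df fg] := Tsurj g dg; exists f.
have Sd g : is_dual_elem g -> is_dual_elem (S g) by move=> /hS[].
have TS g : is_dual_elem g -> T (S g) = g by move=> /hS[].
have ST f : is_dual_elem f -> S (T f) = f.
  by move=> df; apply: Tinj => //; [apply/Sd/Td | apply/TS/Td].
exists S; split=> //; split=> //; split; last split; last split; last split; last split.
- move=> f g df dg; have dfg : is_dual_elem (fun x => f x + g x) by apply: dual_add.
  apply: Tinj; [exact: Sd | by apply: dual_add; apply: Sd |].
  by rewrite TS // TD ?TS //; apply: Sd.
- move=> a f df; have dc := dual_scale a df.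
  apply: Tinj; [exact: Sd | by apply: dual_scale; apply: Sd |].
  by rewrite TS // TZ ?TS //; apply: Sd.
- by move=> f g df dg e; rewrite -(TS f) // e TS.
- by move=> f df; exists (T f); [apply: Td | apply: ST].
- by move=> f df f0; apply: Trefl; [exact: Sd | rewrite TS].
- by move=> f df f0; rewrite -(TS f df); apply: Tpos => //; apply: Sd.
Qed.

(** * The product cone on E * F *)

Section ProductCone.
Variables (R : realType) (E F : normedModType R).
Variables (CE : E -> Prop) (CF : F -> Prop).

Definition prod_cone (v : (E * F)%type) := CE v.1 /\ CF v.2.

Lemma prod_riesz_cone : riesz_cone CE -> riesz_cone CF -> riesz_cone prod_cone.
Proof.
move=> [[E0 ED Eref] EZ Egen] [[F0 FD Fref] FZ Fgen]; split; first split.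
- by [].
- by move=> [x y] [x' y'] [/= a b] [/= c d]; split; [apply: ED | apply: FD].
- move=> [x1 x2] [y1 y2] [z1 z2] [w1 w2] [/= a1 a2] [/= b1 b2] [/= c1 c2] [/= d1 d2].
  move=> [e1 e2].
  have [a [b [c [d [[ha hb hc hd] [-> -> -> ->]]]]]] := Eref _ _ _ _ a1 b1 c1 d1 e1.
  have [a' [b' [c' [d' [[ha' hb' hc' hd'] [-> -> -> ->]]]]]] :=
    Fref _ _ _ _ a2 b2 c2 d2 e2.
  by exists (a, a'), (b, b'), (c, c'), (d, d').
- by move=> a [x y] a0 [/= x0 y0]; split; [apply: EZ | apply: FZ].
- move=> [x y]; have [p [m [p0 m0 ->]]] := Egen x.
  by have [p' [m' [p0' m0' ->]]] := Fgen y; exists (p, p'), (m, m').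
Qed.

End ProductCone.

(** * Extending back along the inverse isomorphism *)

Section Inverse.
Variables (R : realType) (E F G : completeNormedModType R).
Variables (leE : E -> E -> Prop) (leF : F -> F -> Prop) (leG : G -> G -> Prop).
Hypotheses (hE : is_banach_lattice leE) (hF : is_banach_lattice leF).
Hypothesis (hG : is_banach_lattice leG).
Variables (T : (E -> R) -> (F -> R)) (S : (F -> R) -> (E -> R)).
Hypotheses (hT : dual_lattice_iso leE leF T) (hS : dual_lattice_iso leF leE S).
Hypothesis ST : forall f, is_dual_elem f -> S (T f) = f.
Variables (V : lmodType R) (K : V -> Prop) (n : nat).
Hypothesis hK : riesz_cone K.
Variables (inE : E -> V) (inF : F -> V) (outE : V -> E) (outF : V -> F).
Hypotheses (inED : forall x y, inE (x + y) = inE x + inE y)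
  (inEZ : forall (c : R) x, inE (c *: x) = c *: inE x)
  (inE0 : forall x, leE 0 x -> K (inE x)).
Hypotheses (inFD : forall x y, inF (x + y) = inF x + inF y)
  (inFZ : forall (c : R) x, inF (c *: x) = c *: inF x)
  (inF0 : forall x, leF 0 x -> K (inF x)).
Hypotheses (outED : forall x y, outE (x + y) = outE x + outE y)
  (outEZ : forall (c : R) x, outE (c *: x) = c *: outE x)
  (outE0 : forall x, K x -> leE 0 (outE x)).
Hypotheses (outFD : forall x y, outF (x + y) = outF x + outF y)
  (outFZ : forall (c : R) x, outF (c *: x) = c *: outF x)
  (outF0 : forall x, K x -> leF 0 (outF x)).
Hypotheses (outE_inE : forall x, outE (inE x) = x) (outF_inF : forall y, outF (inF y) = y).
Implicit Types (a : ('I_n -> V) -> R) (v : 'I_n -> V).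

Local Notation tauE := (transport T inE outF).
Local Notation tauF := (transport S inF outE).

Lemma tauE_pos s a : pos_form K a -> pos_form K (tauE s a).
Proof. by apply: (transport_pos hE hT hK). Qed.

(** Transported variables are read through [outF] only, and the remaining ones are untouched. *)
Lemma tauE_independent s a v v' : (forall i, outF (v i) = outF (v' i)) ->
  (forall i, i \notin s -> v i = v' i) -> tauE s a v = tauE s a v'.
Proof.
elim: s v v' => [|i s ih] v v' ho hs /=.
  by congr a; apply/funext => i; apply: hs.
rewrite /transport_at ho; congr (T _ _); apply/funext => x; rewrite /slice.
apply: ih => j; rewrite /upd; case: eqVneq => // ji js.
by apply: hs; rewrite in_cons negb_or ji.
Qed.

Definition factors_outE a i := forall v, a (upd v i (inE (outE (v i)))) = a v.

Lemma tauE_factors s a i : (forall j, factors_outE a j) -> i \notin s ->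
  factors_outE (tauE s a) i.
Proof.
move=> ha; elim: s => [|j s ih] /=; first by move=> _; apply: ha.
rewrite in_cons negb_or => /andP[ij /ih{}ih] v.
rewrite /transport_at upd_ne 1?eq_sym //; congr (T _ _); apply/funext => x.
rewrite /slice (upd_comm _ _ _ ij) -[RHS]ih; congr (tauE s a _).
by rewrite upd_ne.
Qed.

(** The variable transported last is undone first: its slice along [inF] is T of the slice along
    [inE], and S cancels T. What remains is evaluated at [outE (v i)], which is harmless as variable
    i was not transported before. *)
Lemma tauF_tauE s a : pos_form K a -> (forall j, factors_outE a j) -> uniq s ->
  tauF (rev s) (tauE s a) = a.
Proof.
move=> ha hf; elim: s => [|i s ih] //= /andP[si us].
rewrite rev_cons -cats1 /transport foldr_cat /=.
have hb := tauE_pos s ha.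
rewrite -[RHS](ih us) /transport; congr (foldr _ _ _).
apply/funext => v; rewrite /(transport_at S) -[RHS](tauE_factors hf si v).
rewrite (_ : slice inF _ v i = T (slice inE (tauE s a) v i)).
  by rewrite ST //; apply: (slice_dual hE hK).
apply/funext => y; rewrite /slice /transport_at upd_at outF_inF.
by rewrite slice_upd_same.
Qed.

Lemma extend_extend (A : ('I_n -> E) -> G -> R) : pos_map leE leG A ->
  extend S inF outE outF inE (extend T inE outF outE inF A) = A.
Proof.
move=> hA; apply/funext => x.
have pos_case g : leG 0 g ->
    extend S inF outE outF inE (extend T inE outF outE inF A) x g = A x g.
  move=> g0; rewrite /extend.
  have ha := base_form_pos outED outEZ outE0 hA g0.
  rewrite (_ : base_form outF _ g = tauE (enum 'I_n) (base_form outE A g)).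
    (* Interchangeability permits undoing the variables in reverse order, as the cancellation
       requires. *)
    rewrite (transport_perm hF hE hS hK inFD inFZ inF0 outED outEZ outE0
      (t := rev (enum 'I_n)) (tauE_pos _ ha)); last by rewrite perm_sym perm_rev.
    rewrite tauF_tauE ?enum_uniq //.
      by rewrite /base_form; congr (A _ g); apply/funext => i; rewrite outE_inE.
    move=> j v; rewrite /base_form; congr (A _ g); apply/funext => i.
    by rewrite /upd; case: eqP => // ->; rewrite outE_inE.
  apply/funext => v; apply: tauE_independent => i; first by rewrite outF_inF.
  by rewrite mem_enum.
apply/funext => g; have [p [m [p0 m0 -> _ _]]] := bl_decomposition hG g.
have hX := extend_pos_map hE hT hK inED inEZ inE0 outFD outFZ outF0 hG
  outED outEZ outE0 inFD inFZ inF0 hA.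
have hY := extend_pos_map hF hS hK inFD inFZ inF0 outED outEZ outE0 hG
  outFD outFZ outF0 inED inEZ inE0 hX.
have [_ /(_ x)[AD AZ] _] := hA; have [_ /(_ x)[YD YZ] _] := hY.
by rewrite -scaleN1r AD AZ YD YZ !pos_case.
Qed.

End Inverse.

(** * Polynomials and symmetric maps *)

Section PositiveSymmetricMaps.
Variables (R : realType) (E G : completeNormedModType R).
Variables (leE : E -> E -> Prop) (leG : G -> G -> Prop).
Hypotheses (hE : is_banach_lattice leE) (hG : is_banach_lattice leG).
Variable n : nat.
Implicit Types (A B : ('I_n -> E) -> G -> R) (P : E -> G -> R).

Definition pos_sym_map A := pos_map leE leG A /\ symmetric_map A.

Definition diagonal A : E -> G -> R := fun x => A (fun _ => x).

Lemma pos_sym_map0 : pos_sym_map (fun _ _ => 0).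
Proof.
split=> //; split=> // [g|v]; split=> *; by rewrite ?addr0 ?mulr0.
Qed.

Lemma pos_sym_mapD A B : pos_sym_map A -> pos_sym_map B ->
  pos_sym_map (fun x g => A x g + B x g).
Proof.
move=> [[Am AG A0] As] [[Bm BG B0] Bs]; split; last first.
  by move=> v s; rewrite As Bs.
split=> [g|v|v g v0 g0]; last by rewrite addr_ge0 ?A0 ?B0.
  have [[AD AZ] [BD BZ]] := (Am g, Bm g).
  by split=> [v i x y|v i c x]; rewrite ?AD ?BD ?AZ ?BZ ?mulrDr // addrACA.
have [[AD AZ] [BD BZ]] := (AG v, BG v).
by split=> [g h|c g]; rewrite ?AD ?BD ?AZ ?BZ ?mulrDr // addrACA.
Qed.

Lemma pos_sym_mapZ (c : R) A : 0 <= c -> pos_sym_map A ->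
  pos_sym_map (fun x g => c * A x g).
Proof.
move=> c0 [[Am AG A0] As]; split; last by move=> v s; rewrite As.
split=> [g|v|v g v0 g0]; last by rewrite mulr_ge0 ?A0.
  have [AD AZ] := Am g.
  by split=> [v i x y|v i d x]; rewrite ?AD ?AZ ?mulrDr // mulrCA.
have [AD AZ] := AG v.
by split=> [g h|d g]; rewrite ?AD ?AZ ?mulrDr // mulrCA.
Qed.

Lemma diagonal_inj A B : pos_sym_map A -> pos_sym_map B ->
  diagonal A = diagonal B -> A = B.
Proof.
move=> [[Am AG A0] As] [[Bm BG B0] Bs] AB.
apply/funext => v; apply/funext => g; apply/eqP; rewrite -subr_eq0; apply/eqP.
have [[AD AZ] [BD BZ]] := (Am g, Bm g).
apply: (polarization (a := fun v => A v g - B v g)) => [|w s|x].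
- by split=> [w i x y|w i c x]; rewrite ?AD ?BD ?AZ ?BZ; lra.
- by rewrite As Bs.
- by rewrite -[A _]/(diagonal A x) AB subrr.
Qed.

(** The bounds contained in [sym_multilinear] come from automatic continuity. *)
Lemma pos_polyP P : pos_poly leE leG n P <-> exists2 A, pos_sym_map A & P = diagonal A.
Proof.
split=> [[A [[[Ad [AD [AZ [As _]]]] PA] A0]]|[A hA ->]].
  exists A; last by apply/funext => x; rewrite PA.
  split=> //; split=> [g|v|v g v0 g0]; last exact: A0.
    by split=> [v i x y|v i c x]; rewrite ?AD ?AZ.
  by have [gD [gZ _]] := Ad v.
have [[Am AG A0] As] := hA.
exists A; split; last by move=> v v0 g g0; apply: A0.
split=> //; split; last split; last split; last split => //.
- by move=> v; apply: (pos_map_dual hE hG); case: hA.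
- by move=> v i x y; apply/funext => g; have [-> _] := Am g.
- by move=> v i c x; apply/funext => g; have [_ ->] := Am g.
- by apply: (joint_bound hE hG); case: hA.
Qed.

Definition represents P (AB : (('I_n -> E) -> G -> R) * (('I_n -> E) -> G -> R)) :=
  [/\ pos_sym_map AB.1, pos_sym_map AB.2 &
    P = fun x g => diagonal AB.1 x g - diagonal AB.2 x g].

Lemma reg_polyP P : reg_poly leE leG n P <-> exists AB, represents P AB.
Proof.
split=> [[P1 [P2 [/pos_polyP[A hA ->] [/pos_polyP[B hB ->] ->]]]]|[[A B] [hA hB ->]]].
  by exists (A, B).
exists (diagonal A), (diagonal B); split; last split=> //.
  by apply/pos_polyP; exists A.
by apply/pos_polyP; exists B.
Qed.

End PositiveSymmetricMaps.

(** * From symmetric maps to regular polynomials *)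

Section Assembly.
Variables (R : realType) (E F G : completeNormedModType R).
Variables (leE : E -> E -> Prop) (leF : F -> F -> Prop) (leG : G -> G -> Prop).
Hypotheses (hE : is_banach_lattice leE) (hF : is_banach_lattice leF).
Hypothesis hG : is_banach_lattice leG.
Variable n : nat.

Local Notation mapsE := (('I_n -> E) -> G -> R).
Local Notation mapsF := (('I_n -> F) -> G -> R).

Definition additive_maps (X : mapsE -> mapsF) :=
  [/\ forall A, pos_sym_map leE leG A -> pos_sym_map leF leG (X A),
      forall A B, pos_sym_map leE leG A -> pos_sym_map leE leG B ->
        X (fun x g => A x g + B x g) = (fun y g => X A y g + X B y g) &
      forall (c : R) A, pos_sym_map leE leG A ->
        X (fun x g => c * A x g) = (fun y g => c * X A y g)].

(** A polynomial represented by the difference of A and B is sent to the difference of the diagonals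
    of X A and X B; polarization makes this independent of the representation. *)
Lemma poly_lattice_iso_of_maps (X : mapsE -> mapsF) (Y : mapsF -> mapsE) :
  additive_maps X -> (forall B, pos_sym_map leF leG B -> pos_sym_map leE leG (Y B)) ->
  (forall A, pos_sym_map leE leG A -> Y (X A) = A) ->
  (forall B, pos_sym_map leF leG B -> X (Y B) = B) ->
  polys_lattice_isomorphic leE leF leG n.
Proof.
move=> [Xp XD XZ] Yp YX XY.
have /choice[r hr] (P : E -> G -> R) :
    exists AB : mapsE * mapsE, reg_poly leE leG n P -> represents leE leG P AB.
  have [/(reg_polyP hE hG)[AB h]|nP] := pselect (reg_poly leE leG n P).
    by exists AB.
  by exists (fun _ _ => 0, fun _ _ => 0).
pose U P : F -> G -> R := fun y g => diagonal (X (r P).1) y g - diagonal (X (r P).2) y g.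
have UE P A B : represents leE leG P (A, B) ->
    U P = fun y g => diagonal (X A) y g - diagonal (X B) y g.
  move=> hP; have [hA hB PE] := hP.
  have [hA' hB' PE'] : represents leE leG P (r P).
    by apply: hr; apply/(reg_polyP hE hG); exists (A, B).
  rewrite /U; move: (r P) hA' hB' PE' => [A' B'] /= hA' hB' PE'.
  (* Equal differences are rewritten as equal sums, which are positive, so that injectivity of the
     diagonal and additivity of X apply. *)
  have e : (fun x g => A x g + B' x g) = (fun x g => A' x g + B x g).
    apply: (diagonal_inj (pos_sym_mapD hA hB') (pos_sym_mapD hA' hB)).
    apply/funext => x; apply/funext => g; rewrite /diagonal.
    have := congr1 (fun Q : E -> G -> R => Q x g) (etrans (esym PE) PE').
    by rewrite /diagonal /=; lra.
  have := congr1 X e; rewrite !XD // => {}e.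
  apply/funext => y; apply/funext => g; rewrite /diagonal.
  by have := congr1 (fun Q : mapsF => Q (fun=> y) g) e; rewrite /=; lra.
have regU P A B : represents leE leG P (A, B) -> represents leF leG (U P) (X A, X B).
  by move=> hP; rewrite (UE _ _ _ hP); have [/= hA hB _] := hP; split=> //=; apply: Xp.
have rep P : reg_poly leE leG n P -> exists A B : mapsE, represents leE leG P (A, B).
  by move=> /(reg_polyP hE hG)[[A B] h]; exists A, B.
exists U; split; last split; last split; last split; last split; last split.
- move=> P /rep[A [B h]]; apply/(reg_polyP hF hG).
  by exists (X A, X B); apply: regU.
- move=> P Q /rep[A [B hP]] /rep[A' [B' hQ]].
  have [/= hA hB PE] := hP; have [/= hA' hB' QE] := hQ.
  rewrite (UE _ _ _ hP) (UE _ _ _ hQ).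
  rewrite (UE _ (fun x g => A x g + A' x g) (fun x g => B x g + B' x g)).
    rewrite !XD //; apply/funext => y; apply/funext => g.
    by rewrite /diagonal opprD addrACA.
  split=> /=; try exact: pos_sym_mapD.
  by apply/funext => y; apply/funext => g; rewrite PE QE /diagonal opprD addrACA.
- move=> c P /rep[A [B hP]]; have [/= hA hB PE] := hP; rewrite (UE _ _ _ hP).
  have [c0|/ltW c0] := lerP 0 c.
    rewrite (UE _ (fun x g => c * A x g) (fun x g => c * B x g)).
      rewrite !XZ //; apply/funext => y; apply/funext => g.
      by rewrite /diagonal mulrBr.
    split=> /=; try exact: pos_sym_mapZ.
    by apply/funext => y; apply/funext => g; rewrite PE /diagonal mulrBr.
  (* A negative scalar exchanges the two representing maps. *)
  have nc0 : 0 <= - c by rewrite oppr_ge0.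
  rewrite (UE _ (fun x g => - c * B x g) (fun x g => - c * A x g)).
    rewrite !XZ //; apply/funext => y; apply/funext => g.
    by rewrite /diagonal; lra.
  split=> /=; try exact: pos_sym_mapZ.
  by apply/funext => y; apply/funext => g; rewrite PE /diagonal; lra.
- move=> P Q /rep[A [B hP]] /rep[A' [B' hQ]].
  have [/= hA hB PE] := hP; have [/= hA' hB' QE] := hQ.
  rewrite (UE _ _ _ hP) (UE _ _ _ hQ) => e.
  have h1 := pos_sym_mapD hA hB'; have h2 := pos_sym_mapD hA' hB.
  have : X (fun x g => A x g + B' x g) = X (fun x g => A' x g + B x g).
    apply: (diagonal_inj (Xp _ h1) (Xp _ h2)).
    rewrite !XD //; apply/funext => y; apply/funext => g.
    have := congr1 (fun Q : F -> G -> R => Q y g) e.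
    by rewrite /diagonal /=; lra.
  move=> /(congr1 Y); rewrite !YX // => {}e.
  rewrite PE QE; apply/funext => x; apply/funext => g.
  have := congr1 (fun Q : mapsE => Q (fun=> x) g) e.
  by rewrite /diagonal /=; lra.
- move=> Q /(reg_polyP hF hG)[[A B] [/= hA hB QE]].
  have hP : represents leE leG (fun x g => diagonal (Y A) x g - diagonal (Y B) x g)
      (Y A, Y B) by split=> //=; apply: Yp.
  exists (fun x g => diagonal (Y A) x g - diagonal (Y B) x g).
    by apply/(reg_polyP hE hG); exists (Y A, Y B).
  by rewrite (UE _ _ _ hP) !XY.
- move=> P _ /(pos_polyP hE hG)[A hA PE]; apply/(pos_polyP hF hG).
  exists (X A); first exact: Xp.
  have h0 := pos_sym_map0 leE leG n.
  have hP : represents leE leG P (A, fun _ _ => 0).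
    by split=> //=; rewrite PE; apply/funext => x; apply/funext => g; rewrite /diagonal subr0.
  rewrite (UE _ _ _ hP); apply/funext => y; apply/funext => g.
  suff -> : diagonal (X (fun _ _ => 0)) y g = 0 by rewrite subr0.
  rewrite (_ : (fun _ _ => 0) = fun (x : 'I_n -> E) (g : G) => 0 * A x g).
    by rewrite XZ // /diagonal mul0r.
  by apply/funext => x; apply/funext => h; rewrite mul0r.
- move=> P /rep[A [B hP]] /(pos_polyP hF hG)[D hD UD]; apply/(pos_polyP hE hG).
  have [/= hA hB PE] := hP; rewrite (UE _ _ _ hP) in UD.
  exists (Y D); first exact: Yp.
  have hYB := pos_sym_mapD (Yp _ hD) hB.
  (* Applying Y turns this into A = Y D + B, so P is the diagonal of Y D. *)
  have e : X A = X (fun x g => Y D x g + B x g).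
    apply: (diagonal_inj (Xp _ hA) (Xp _ hYB)).
    rewrite XD ?XY //; last exact: Yp.
    apply/funext => y; apply/funext => g.
    have := congr1 (fun Q : F -> G -> R => Q y g) UD.
    by rewrite /diagonal /=; lra.
  move/(congr1 Y): e; rewrite !YX // => e.
  rewrite PE e; apply/funext => x; apply/funext => g.
  by rewrite /diagonal addrK.
Qed.

End Assembly.

(** * Conclusion: extensions in both directions on E * F *)

Theorem theorem2p5 (R : realType)
    (E F : completeNormedModType R) (leE : E -> E -> Prop) (leF : F -> F -> Prop)
    (hE : is_banach_lattice leE) (hF : is_banach_lattice leF)
    (hiso : duals_lattice_isomorphic leE leF)
    (hoc : dual_order_continuous leE \/ dual_order_continuous leF) :
  forall (n : nat) (G : completeNormedModType R) (leG : G -> G -> Prop),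
    is_banach_lattice leG ->
    polys_lattice_isomorphic leE leF leG n.
Proof.
move=> n G leG hG; have [T hT] := hiso.
have [S [hS ST TS]] := dual_lattice_iso_inverse hT.
have hK := prod_riesz_cone (bl_riesz_cone hE) (bl_riesz_cone hF).
set K := prod_cone _ _ in hK.
pose V : lmodType R := (E * F)%type.
pose inE (x : E) : V := (x, 0); pose inF (y : F) : V := (0, y).
pose outE (v : V) : E := v.1; pose outF (v : V) : F := v.2.
have inED x y : inE (x + y) = inE x + inE y by congr pair; rewrite addr0.
have inEZ (c : R) x : inE (c *: x) = c *: inE x by congr pair; rewrite scaler0.
have inE0 x : leE 0 x -> K (inE x) by split=> //; apply: (bl_refl hF).
have inFD x y : inF (x + y) = inF x + inF y by congr pair; rewrite addr0.
have inFZ (c : R) x : inF (c *: x) = c *: inF x by congr pair; rewrite scaler0.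
have inF0 x : leF 0 x -> K (inF x) by split=> //; apply: (bl_refl hE).
have outED x y : outE (x + y) = outE x + outE y by [].
have outEZ (c : R) x : outE (c *: x) = c *: outE x by [].
have outE0 x : K x -> leE 0 (outE x) by case.
have outFD x y : outF (x + y) = outF x + outF y by [].
have outFZ (c : R) x : outF (c *: x) = c *: outF x by [].
have outF0 x : K x -> leF 0 (outF x) by case.
apply: (@poly_lattice_iso_of_maps _ E F G leE leF leG hE hF hG n
  (extend T inE outF outE inF) (extend S inF outE outF inE)).
- split=> [A [hA As]|A B [hA _] [hB _]|c A [hA _]].
  + split; first exact: (extend_pos_map hE hT hK inED inEZ inE0 outFD outFZ outF0 hG
      outED outEZ outE0 inFD inFZ inF0 hA).
    exact: (extend_symmetric hE hF hT hK inED inEZ inE0 outFD outFZ outF0 hG inF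
      outED outEZ outE0 hA As).
  + exact: (extend_add hE hT hK inED inEZ inE0 outFD outFZ outF0 hG inF
      outED outEZ outE0 hA hB).
  + exact: (extend_scale hE hT hK inED inEZ inE0 outFD outFZ outF0 hG inF
      outED outEZ outE0 c hA).
- move=> B [hB Bs]; split.
    exact: (extend_pos_map hF hS hK inFD inFZ inF0 outED outEZ outE0 hG
      outFD outFZ outF0 inED inEZ inE0 hB).
  exact: (extend_symmetric hF hE hS hK inFD inFZ inF0 outED outEZ outE0 hG inE
    outFD outFZ outF0 hB Bs).
- by move=> A [hA _]; apply: (extend_extend hE hF hG hT hS ST hK inED inEZ inE0
    inFD inFZ inF0 outED outEZ outE0 outFD outFZ outF0).
- by move=> B [hB _]; apply: (extend_extend hF hE hG hS hT TS hK inFD inFZ inF0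
    inED inEZ inE0 outFD outFZ outF0 outED outEZ outE0).
Qed.
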